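(* Let $\Omega\subset\mathbb R^2$ be a domain, $D=(\mu,\mathcal A,\mathcal B,\mathcal F)\in\mathcal{BV}(\Omega)$ with spectral root $\lambda=i(1+\mu)/(1-\mu)$, and let $S=(\varphi,\psi)$ with $\varphi,\psi\in C^1(\Omega;\mathbb C)$ and $|\psi|>|\varphi|$ pointwise (so that the real matrix field of $S$ has $\det S=|\varphi|^2-|\psi|^2<0$). Then the substituted real system $S^\sharp D$ is elliptic, its determinant conic being the conic of the realification of $D$ multiplied by $\det S<0$; its skeleton form has $a_{11}<0$, but its structure data still satisfy $4\alpha-\beta^2>0$, and the pipeline formulas extend verbatim with the root $\lambda$ in the upper half-plane. With $\pi$ so extended and $D_S=(\mu_S,\mathcal A_S,\mathcal B_S,\mathcal F_S):=\pi(S^\sharp D)$ (equivalently, $D_S:=E_{S^\sharp D}(\omega_0')$, where $\omega_0'=(a_{22}-\lambda a_{12},\lambda)$ is computed from the skeleton coefficients of $S^\sharp D$), $$D_S=\frac{-i\lambda}{\varphi-\psi}\cdot D .$$ In particular $\mu_S=\mu$, $|\mathcal B_S|=|\mathcal B|$, and $\Theta_{D_S}=\Theta_D$. Consequently the symmetry groupoid extends to $\mathrm{GL}(2,\mathbb R)$-valued substitutions with nowhere-vanishing determinant: every assignment on BV data that is invariant under the gauge action and under pullback by orientation-preserving diffeomorphisms, evaluated on the (extended) normal form $\pi(L)$ of a real elliptic system $L$, is unchanged under left multiplication of $L$ by $M\in C^0(\Omega;\mathrm{GL}(2,\mathbb R))$, under substitutions $(u,v)^{\mathsf T}=S(u',v')^{\mathsf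 T}$ with $S\in C^1(\Omega;\mathrm{GL}(2,\mathbb R))$, and under orientation-preserving coordinate changes.
   Context: **Notation.** $z=x+iy$, $\partial_z=\frac12(\partial_x-i\partial_y)$, $\partial_{\bar z}=\frac12(\partial_x+i\partial_y)$, $\mathbb C^*=\mathbb C\setminus\{0\}$. **BV data.** $\mathcal{BV}(\Omega)$ is the set of $D=(\mu,\mathcal A,\mathcal B,\mathcal F)$ with $\mu\in C^1(\Omega;\mathbb C)$, $|\mu|<1$ pointwise, $\mathcal A,\mathcal B,\mathcal F\in C^0(\Omega;\mathbb C)$; $\mathrm{Res}_D(w):=w_{\bar z}-\mu w_z+\mathcal Aw+\mathcal B\bar w-\mathcal F$, and the BV equation is $\mathrm{Res}_D(w)=0$. Density $\Theta_D=\frac{|\mathcal B|^2}{1-|\mu|^2}dx\,dy$. **Gauge action.** For $\phi\in C^1(\Omega;\mathbb C^* )$, $\phi\cdot D:=(\mu',\mathcal A',\mathcal B',\mathcal F')$ with $\mu'=\mu$, $\mathcal A'=\mathcal A-\frac{\phi_{\bar z}}{\phi}+\mu\frac{\phi_z}{\phi}$, $\mathcal B'=\mathcal B\frac{\phi}{\bar\phi}$, $\mathcal F'=\phi\mathcal F$. **Diffeomorphism pullback.** For an orientation-preserving $C^1$ diffeomorphism $\chi:\Omega'\to\Omega$ (coordinate $\zeta$), $\chi^*D$ is the datum of the equation satisfied by $w\circ\chi$, normalized to BV form: with $J=|\chi_\zeta|^2-|\chi_{\bar\zeta}|^2$ and $\kappa=J/(\chi_\zeta+(\mu\circ\chi)\overline{\chi_{\bar\zeta}})$,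 $\chi^*D=\big(\frac{\chi_{\bar\zeta}+(\mu\circ\chi)\overline{\chi_\zeta}}{\chi_\zeta+(\mu\circ\chi)\overline{\chi_{\bar\zeta}}},\kappa\,\mathcal A\circ\chi,\kappa\,\mathcal B\circ\chi,\kappa\,\mathcal F\circ\chi\big)$. Invariance is required whenever $\chi^*D$ is again a BV datum, and coordinate changes are considered between systems for which the normal form is defined. **Realification and substitution.** The realification of $D$ is the pair of real equations $\operatorname{Re}\mathrm{Res}_D(w)=0$, $\operatorname{Im}\mathrm{Res}_D(w)=0$ in real unknowns $(u,v)$, $w=u+iv$. $S^\sharp D$ is the real system obtained by substituting $w=\varphi v'+\psi\overline{v'}$ into the equation of $D$ and separating real and imaginary parts, with unknowns the real and imaginary parts of $v'$ in this order (playing the roles of $(u,v)$ below). As a real matrix field, $S$ is the matrix of $\zeta\mapsto\varphi\zeta+\psi\bar\zeta$ in the basis $(1,i)$. The determinant conic of a system $A_1V_x+A_2V_y+A_0V=k$ is $\xi\mapsto\det(\xi_1A_1+\xi_2A_2)$. **Skeleton form.** A real first-order system is in skeleton form if it reads $$-v_y+a_{11}u_x+a_{12}u_y+a_{13}u+a_{14}v=f_1,\qquad v_x+a_{21}u_x+a_{22}u_y+a_{23}u+a_{24}v=f_2,$$ with real $a_{i1},a_{i2}\in C^1(\Omega)$, $a_{i3},a_{i4},f_i\in C^0(\Omega)$; a system is brought to this form by left multiplication by an invertible matrix field (unique). The unextended admissible class requires $a_{11}>0$ and $a_{11}a_{22}-\frac14(a_{12}+a_{21})^2>0$; the extended class requires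 only $a_{11}\neq0$ and $4\alpha-\beta^2>0$, with $\alpha=a_{22}/a_{11}$, $\beta=-(a_{12}+a_{21})/a_{11}$ (structure data). **(Extended) pipeline $\pi$.** For a system put in skeleton form, $\lambda=\frac12(-\beta+i\sqrt{4\alpha-\beta^2})$, $\mu=(\lambda-i)/(\lambda+i)$. With $U=a_{22}u$, $V=v-a_{12}u$, multiplying the first equation by $\alpha$, and adding $\beta$ times the first skeleton equation to the second, one gets $U_x-\alpha V_y+aU+bV=f$, $V_x+U_y-\beta V_y+cU+dV=g$, where $a=\frac{-(a_{22})_x-\alpha (a_{12})_y+\alpha a_{13}+\alpha a_{14}a_{12}}{a_{22}}$, $b=\alpha a_{14}$, $c=\frac{(a_{12})_x-(a_{22})_y-\beta(a_{12})_y+a_{23}+\beta a_{13}+a_{12}(a_{24}+\beta a_{14})}{a_{22}}$, $d=a_{24}+\beta a_{14}$, $f=\alpha f_1$, $g=f_2+\beta f_1$. Let $G_1,G_2$ be real with $\lambda_x+\lambda\lambda_y=G_1+G_2\lambda$, $\tilde b=b-G_1$, $\tilde d=d-G_2$; let $A_\lambda,B_\lambda$ be the unique complex functions with $A_\lambda(U+\lambda V)+B_\lambda(U+\bar\lambda V)=\frac12[(aU+\tilde bV)+\lambda(cU+\tilde dV)]$ for all real $U,V$, and $F_\lambda=\frac12(f+\lambda g)$. Then $\pi$ of the system is $(\mu,(1-\mu)A_\lambda,(1-\mu)B_\lambda,(1-\mu)F_\lambda)$. **Eigenpairing equation.** Left multiplication by the inverse of the $\partial_x$-coefficient matrix puts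 a system $L$ in the form $V_x+NV_y+PV=h$, $V=(u,v)^{\mathsf T}$. For a nowhere-vanishing row vector field $\omega\in C^1(\Omega;\mathbb C^2)$ with $\omega N=\lambda\omega$, where $\lambda$ is the eigenvalue of $N$ in the upper half-plane, $E_L(\omega)=(\mu,\mathcal A,\mathcal B,\mathcal F)$ with $\mu=\frac{\lambda-i}{\lambda+i}$, $(\mathcal A,\mathcal B)=-\frac{(\omega_x+\lambda\omega_y-\omega P)\,\Xi_\omega^{-1}}{1-i\lambda}$, $\mathcal F=\frac{\omega h}{1-i\lambda}$, where $\Xi_\omega$ is the $2\times2$ matrix with rows $\omega,\bar\omega$ (which is invertible). *)

(* Defs.v *)
From Stdlib Require Import Reals Lra.
From Coquelicot Require Import Coquelicot.

Set Implicit Arguments.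
Unset Strict Implicit.

Local Open Scope C_scope.

(* [C] is [R * R], so it serves as the plane (z = x + iy is the point (x, y)),
   as the complex field, and as the space of real column vectors
   (u, v)^T = u + iv.  Functions on a domain are total functions on [C] whose
   values outside the domain are irrelevant: every predicate below is
   relativised to the domain. *)

Definition plane_domain (Om : C -> Prop) : Prop :=
  open Om /\ (exists z, Om z) /\
  (forall U V : C -> Prop, open U -> open V ->
     (forall z, Om z -> U z \/ V z) ->
     (forall z, Om z -> U z -> V z -> False) ->
     (forall z, Om z -> U z) \/ (forall z, Om z -> V z)).

Definition dxR (f : C -> R) (z : C) : R := Derive (fun t => f (t, Im z)) (Re z).
Definition dyR (f : C -> R) (z : C) : R := Derive (fun t => f (Re z, t)) (Im z).

Definition dx (f : C -> C) (z : C) : C :=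
  (dxR (fun p => Re (f p)) z, dxR (fun p => Im (f p)) z).
Definition dy (f : C -> C) (z : C) : C :=
  (dyR (fun p => Re (f p)) z, dyR (fun p => Im (f p)) z).
Definition dz (f : C -> C) (z : C) : C := / 2 * (dx f z - Ci * dy f z).
Definition dzbar (f : C -> C) (z : C) : C := / 2 * (dx f z + Ci * dy f z).

Definition isC0R (Om : C -> Prop) (f : C -> R) : Prop :=
  forall z, Om z -> continuous f z.
Definition isC0 (Om : C -> Prop) (f : C -> C) : Prop :=
  forall z, Om z -> continuous f z.

Definition isC1R (Om : C -> Prop) (f : C -> R) : Prop :=
  forall z, Om z ->
    ex_derive (fun t => f (t, Im z)) (Re z) /\
    ex_derive (fun t => f (Re z, t)) (Im z) /\
    continuous (dxR f) z /\ continuous (dyR f) z.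
Definition isC1 (Om : C -> Prop) (f : C -> C) : Prop :=
  isC1R Om (fun p => Re (f p)) /\ isC1R Om (fun p => Im (f p)).

Record mat2 (T : Type) := Mat2 { m11 : T; m12 : T; m21 : T; m22 : T }.

Definition det2 (M : mat2 R) : R := (m11 M * m22 M - m12 M * m21 M)%R.
Definition madd (M N : mat2 R) : mat2 R :=
  Mat2 (m11 M + m11 N)%R (m12 M + m12 N)%R (m21 M + m21 N)%R (m22 M + m22 N)%R.
Definition mscal (c : R) (M : mat2 R) : mat2 R :=
  Mat2 (c * m11 M)%R (c * m12 M)%R (c * m21 M)%R (c * m22 M)%R.
Definition mmul (M N : mat2 R) : mat2 R :=
  Mat2 (m11 M * m11 N + m12 M * m21 N)%R (m11 M * m12 N + m12 M * m22 N)%R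
       (m21 M * m11 N + m22 M * m21 N)%R (m21 M * m12 N + m22 M * m22 N)%R.
Definition minv (M : mat2 R) : mat2 R :=
  mscal (/ det2 M)%R (Mat2 (m22 M) (- m12 M)%R (- m21 M)%R (m11 M)).
Definition mapp (M : mat2 R) (V : C) : C :=
  ((m11 M * Re V + m12 M * Im V)%R, (m21 M * Re V + m22 M * Im V)%R).

Definition Cdet2 (M : mat2 C) : C := m11 M * m22 M - m12 M * m21 M.
Definition Cminv (M : mat2 C) : mat2 C :=
  Mat2 (m22 M / Cdet2 M) (- m12 M / Cdet2 M) (- m21 M / Cdet2 M) (m11 M / Cdet2 M).
Definition rowmul (r : C * C) (M : mat2 C) : C * C :=
  (fst r * m11 M + snd r * m21 M, fst r * m12 M + snd r * m22 M).
Definition rowapp (r : C * C) (V : C) : C :=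
  fst r * RtoC (Re V) + snd r * RtoC (Im V).
Definition toC (M : mat2 R) : mat2 C :=
  Mat2 (RtoC (m11 M)) (RtoC (m12 M)) (RtoC (m21 M)) (RtoC (m22 M)).

Definition entrywise (P : (C -> R) -> Prop) (M : C -> mat2 R) : Prop :=
  P (fun z => m11 (M z)) /\ P (fun z => m12 (M z)) /\
  P (fun z => m21 (M z)) /\ P (fun z => m22 (M z)).
Definition dxM (M : C -> mat2 R) (z : C) : mat2 R :=
  Mat2 (dxR (fun p => m11 (M p)) z) (dxR (fun p => m12 (M p)) z)
       (dxR (fun p => m21 (M p)) z) (dxR (fun p => m22 (M p)) z).
Definition dyM (M : C -> mat2 R) (z : C) : mat2 R :=
  Mat2 (dyR (fun p => m11 (M p)) z) (dyR (fun p => m12 (M p)) z)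
       (dyR (fun p => m21 (M p)) z) (dyR (fun p => m22 (M p)) z).

Definition GL2 (Om : C -> Prop) (M : C -> mat2 R) : Prop :=
  forall z, Om z -> det2 (M z) <> 0%R.

(* The real matrix of zeta |-> a zeta + b (Cconj zeta) in the basis (1, i). *)
Definition rlin (a b : C) : mat2 R :=
  Mat2 (Re a + Re b)%R (Im b - Im a)%R (Im a + Im b)%R (Re a - Re b)%R.

Lemma rlinE (a b V : C) : mapp (rlin a b) V = a * V + b * Cconj V.
Proof.
destruct a, b, V; unfold mapp, rlin, Re, Im, Cplus, Cmult, Cconj; cbn.
f_equal; ring.
Qed.

Record bv := Bv { bmu : C -> C; bA : C -> C; bB : C -> C; bF : C -> C }.

Definition BV (Om : C -> Prop) (D : bv) : Prop :=
  isC1 Om (bmu D) /\ (forall z, Om z -> (Cmod (bmu D z) < 1)%R) /\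
  isC0 Om (bA D) /\ isC0 Om (bB D) /\ isC0 Om (bF D).

Definition bv_eq (Om : C -> Prop) (D D' : bv) : Prop :=
  forall z, Om z -> bmu D z = bmu D' z /\ bA D z = bA D' z /\
                    bB D z = bB D' z /\ bF D z = bF D' z.

Definition Res (D : bv) (w : C -> C) (z : C) : C :=
  dzbar w z - bmu D z * dz w z + bA D z * w z + bB D z * Cconj (w z) - bF D z.

(* Coefficient of dx dy in the density Theta_D. *)
Definition Theta (D : bv) (z : C) : R :=
  (Cmod (bB D z) ^ 2 / (1 - Cmod (bmu D z) ^ 2))%R.

Definition spectral_root (mu : C -> C) (z : C) : C :=
  Ci * (1 + mu z) / (1 - mu z).

Definition gauge (phi : C -> C) (D : bv) : bv :=
  Bv (bmu D)
     (fun z => bA D z - dzbar phi z / phi z + bmu D z * (dz phi z / phi z))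
     (fun z => bB D z * (phi z / Cconj (phi z)))
     (fun z => phi z * bF D z).

Definition jac (chi : C -> C) (z : C) : R :=
  (Cmod (dz chi z) ^ 2 - Cmod (dzbar chi z) ^ 2)%R.

Definition or_diffeo (Om' Om : C -> Prop) (chi : C -> C) : Prop :=
  isC1 Om' chi /\ (forall z, Om' z -> (0 < jac chi z)%R) /\
  exists theta : C -> C, isC1 Om theta /\
    (forall z, Om' z -> Om (chi z) /\ theta (chi z) = z) /\
    (forall z, Om z -> Om' (theta z) /\ chi (theta z) = z).

Definition pullback (chi : C -> C) (D : bv) : bv :=
  let den z := dz chi z + bmu D (chi z) * Cconj (dzbar chi z) in
  let kappa z := RtoC (jac chi z) / den z in
  Bv (fun z => (dzbar chi z + bmu D (chi z) * Cconj (dz chi z)) / den z)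
     (fun z => kappa z * bA D (chi z))
     (fun z => kappa z * bB D (chi z))
     (fun z => kappa z * bF D (chi z)).

Record rsys := Rsys
  { sA1 : C -> mat2 R; sA2 : C -> mat2 R; sA0 : C -> mat2 R; sk : C -> C }.

Definition sys_res (L : rsys) (V : C -> C) (z : C) : C :=
  mapp (sA1 L z) (dx V z) + mapp (sA2 L z) (dy V z) + mapp (sA0 L z) (V z) - sk L z.

Definition conic (L : rsys) (z : C) (xi1 xi2 : R) : R :=
  det2 (madd (mscal xi1 (sA1 L z)) (mscal xi2 (sA2 L z))).

Definition elliptic (Om : C -> Prop) (L : rsys) : Prop :=
  forall z, Om z -> forall xi1 xi2 : R,
    (xi1, xi2) <> (0%R, 0%R) -> conic L z xi1 xi2 <> 0%R.

Definition left_mul (M : C -> mat2 R) (L : rsys) : rsys :=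
  Rsys (fun z => mmul (M z) (sA1 L z)) (fun z => mmul (M z) (sA2 L z))
       (fun z => mmul (M z) (sA0 L z)) (fun z => mapp (M z) (sk L z)).

Definition subst (S : C -> mat2 R) (L : rsys) : rsys :=
  Rsys (fun z => mmul (sA1 L z) (S z)) (fun z => mmul (sA2 L z) (S z))
       (fun z => madd (mmul (sA0 L z) (S z))
                   (madd (mmul (sA1 L z) (dxM S z)) (mmul (sA2 L z) (dyM S z))))
       (sk L).

Lemma substE (Om : C -> Prop) (S : C -> mat2 R) (L : rsys) (V : C -> C) (z : C) :
  entrywise (isC1R Om) S -> isC1 Om V -> Om z ->
  sys_res (subst S L) V z = sys_res L (fun p => mapp (S p) (V p)) z.
Proof.
intros (S1 & S2 & S3 & S4) (V1 & V2) Hz.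
destruct (S1 z Hz) as (X1 & Y1 & _); destruct (S2 z Hz) as (X2 & Y2 & _);
  destruct (S3 z Hz) as (X3 & Y3 & _); destruct (S4 z Hz) as (X4 & Y4 & _);
  destruct (V1 z Hz) as (Xu & Yu & _); destruct (V2 z Hz) as (Xv & Yv & _).
unfold sys_res, dx, dy, dxR, dyR, mapp; cbn [Re Im fst snd].
rewrite !Derive_plus by (apply ex_derive_mult; assumption).
rewrite !Derive_mult by assumption.
destruct z as [x y]; cbn; unfold dxR, dyR; cbn.
unfold Cminus, Cplus, Copp; cbn; f_equal; ring.
Qed.

(* The system satisfied by V o chi when V solves L: with chi = (chi1, chi2) and
   coordinates (s, t) on the source, V_x o chi and V_y o chi are expressed by
   the s- and t-derivatives of V o chi through the inverse Jacobian matrix. *)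
Definition coord_change (chi : C -> C) (L : rsys) : rsys :=
  let Di z := minv (Mat2 (Re (dx chi z)) (Re (dy chi z))
                         (Im (dx chi z)) (Im (dy chi z))) in
  Rsys (fun z => madd (mscal (m11 (Di z)) (sA1 L (chi z)))
                      (mscal (m12 (Di z)) (sA2 L (chi z))))
       (fun z => madd (mscal (m21 (Di z)) (sA1 L (chi z)))
                      (mscal (m22 (Di z)) (sA2 L (chi z))))
       (fun z => sA0 L (chi z))
       (fun z => sk L (chi z)).

(* w_zbar - mu w_z = (1 - mu)/2 w_x + i (1 + mu)/2 w_y. *)
Definition realification (D : bv) : rsys :=
  Rsys (fun z => rlin ((1 - bmu D z) / 2) 0)
       (fun z => rlin (Ci * (1 + bmu D z) / 2) 0)
       (fun z => rlin (bA D z) (bB D z))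
       (bF D).

Lemma realificationE (D : bv) (w : C -> C) (z : C) :
  sys_res (realification D) w z = Res D w z.
Proof.
unfold sys_res, realification, Res, dz, dzbar; cbn; rewrite !rlinE; field.
Qed.

Definition Smat (phi psi : C -> C) (z : C) : mat2 R := rlin (phi z) (psi z).

Definition sharp (phi psi : C -> C) (D : bv) : rsys :=
  subst (Smat phi psi) (realification D).

Record skeleton := Skeleton
  { a11 : C -> R; a12 : C -> R; a13 : C -> R; a14 : C -> R;
    a21 : C -> R; a22 : C -> R; a23 : C -> R; a24 : C -> R;
    f1 : C -> R; f2 : C -> R }.

Definition is_skeleton_sys (L : rsys) (z : C) : Prop :=
  m12 (sA1 L z) = 0%R /\ m22 (sA1 L z) = 1%R /\
  m12 (sA2 L z) = (-1)%R /\ m22 (sA2 L z) = 0%R.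

(* The left multiplier sending the second columns of A1 and A2 to (0, 1)^T and
   (-1, 0)^T is the inverse of this matrix. *)
Definition skel_den (L : rsys) (z : C) : mat2 R :=
  Mat2 (- m12 (sA2 L z))%R (m12 (sA1 L z)) (- m22 (sA2 L z))%R (m22 (sA1 L z)).

Definition skel_sys (L : rsys) : rsys :=
  left_mul (fun z => minv (skel_den L z)) L.

Lemma skel_sysP (L : rsys) (z : C) :
  det2 (skel_den L z) <> 0%R -> is_skeleton_sys (skel_sys L) z.
Proof.
unfold is_skeleton_sys, skel_sys, left_mul, mmul, minv, mscal, skel_den, det2; cbn.
intros H; repeat split; field; exact H.
Qed.

Lemma skel_sys_unique (L : rsys) (M : C -> mat2 R) (z : C) :
  is_skeleton_sys (left_mul M L) z ->
  det2 (skel_den L z) <> 0%R /\ M z = minv (skel_den L z).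
Proof.
unfold is_skeleton_sys, left_mul, mmul, minv, mscal, skel_den, det2; cbn.
destruct (M z) as [p q r s]; destruct (sA1 L z) as [a b c d];
  destruct (sA2 L z) as [a' b' c' d']; cbn; intros (H1 & H2 & H3 & H4).
assert (Hd : (- b' * d - b * - d' <> 0)%R).
{ intros E.
  assert (H : ((p * s - q * r) * (- b' * d - b * - d') = 1)%R).
  { replace 1%R with ((r * b + s * d) * - (p * b' + q * d')
       - (p * b + q * d) * - (r * b' + s * d'))%R by (rewrite H1, H2, H3, H4; ring).
    ring. }
  rewrite E, Rmult_0_r in H; lra. }
split; [exact Hd|].
assert (Hp : (p * (- b' * d - b * - d') = d)%R).
{ transitivity (- (p * b' + q * d') * d + (p * b + q * d) * d')%R;
    [ring | rewrite H1, H3; ring]. }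
assert (Hq : (q * (- b' * d - b * - d') = - b)%R).
{ transitivity ((p * b' + q * d') * b - (p * b + q * d) * b')%R;
    [ring | rewrite H1, H3; ring]. }
assert (Hr : (r * (- b' * d - b * - d') = d')%R).
{ transitivity ((r * b + s * d) * d' - (r * b' + s * d') * d)%R;
    [ring | rewrite H2, H4; ring]. }
assert (Hs : (s * (- b' * d - b * - d') = - b')%R).
{ transitivity (- (r * b + s * d) * b' + (r * b' + s * d') * b)%R;
    [ring | rewrite H2, H4; ring]. }
f_equal; apply Rmult_eq_reg_r with (2 := Hd);
  rewrite ?Hp, ?Hq, ?Hr, ?Hs; field; exact Hd.
Qed.

Definition skeleton_of (L : rsys) : skeleton :=
  let K := skel_sys L in
  Skeleton (fun z => m11 (sA1 K z)) (fun z => m11 (sA2 K z))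
           (fun z => m11 (sA0 K z)) (fun z => m12 (sA0 K z))
           (fun z => m21 (sA1 K z)) (fun z => m21 (sA2 K z))
           (fun z => m21 (sA0 K z)) (fun z => m22 (sA0 K z))
           (fun z => Re (sk K z)) (fun z => Im (sk K z)).

Definition regular_skeleton (Om : C -> Prop) (s : skeleton) : Prop :=
  isC1R Om (a11 s) /\ isC1R Om (a12 s) /\ isC1R Om (a21 s) /\ isC1R Om (a22 s) /\
  isC0R Om (a13 s) /\ isC0R Om (a14 s) /\ isC0R Om (a23 s) /\ isC0R Om (a24 s) /\
  isC0R Om (f1 s) /\ isC0R Om (f2 s).

Definition has_skeleton_form (Om : C -> Prop) (L : rsys) : Prop :=
  (forall z, Om z -> det2 (skel_den L z) <> 0%R) /\
  regular_skeleton Om (skeleton_of L).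

Definition alpha (s : skeleton) (z : C) : R := (a22 s z / a11 s z)%R.
Definition beta (s : skeleton) (z : C) : R := (- (a12 s z + a21 s z) / a11 s z)%R.

Definition extended_class (Om : C -> Prop) (L : rsys) : Prop :=
  has_skeleton_form Om L /\
  (forall z, Om z -> a11 (skeleton_of L) z <> 0%R /\
     (0 < 4 * alpha (skeleton_of L) z - beta (skeleton_of L) z ^ 2)%R).

Definition lam (s : skeleton) (z : C) : C :=
  / 2 * (- RtoC (beta s z) + Ci * RtoC (sqrt (4 * alpha s z - beta s z ^ 2))).
Definition pmu (s : skeleton) (z : C) : C := (lam s z - Ci) / (lam s z + Ci).

Definition pa (s : skeleton) (z : C) : R :=
  ((- dxR (a22 s) z - alpha s z * dyR (a12 s) z + alpha s z * a13 s z
    + alpha s z * a14 s z * a12 s z) / a22 s z)%R.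
Definition pb (s : skeleton) (z : C) : R := (alpha s z * a14 s z)%R.
Definition pc (s : skeleton) (z : C) : R :=
  ((dxR (a12 s) z - dyR (a22 s) z - beta s z * dyR (a12 s) z + a23 s z
    + beta s z * a13 s z + a12 s z * (a24 s z + beta s z * a14 s z)) / a22 s z)%R.
Definition pd (s : skeleton) (z : C) : R := (a24 s z + beta s z * a14 s z)%R.
Definition pf (s : skeleton) (z : C) : R := (alpha s z * f1 s z)%R.
Definition pg (s : skeleton) (z : C) : R := (f2 s z + beta s z * f1 s z)%R.

Definition lam_drift (s : skeleton) (z : C) : C :=
  dx (lam s) z + lam s z * dy (lam s) z.
Definition G2 (s : skeleton) (z : C) : R := (Im (lam_drift s z) / Im (lam s z))%R.
Definition G1 (s : skeleton) (z : C) : R :=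
  (Re (lam_drift s z) - G2 s z * Re (lam s z))%R.
Definition pbt (s : skeleton) (z : C) : R := (pb s z - G1 s z)%R.
Definition pdt (s : skeleton) (z : C) : R := (pd s z - G2 s z)%R.

Definition Alam (s : skeleton) (z : C) : C :=
  (RtoC (pbt s z) + lam s z * RtoC (pdt s z)
     - Cconj (lam s z) * (RtoC (pa s z) + lam s z * RtoC (pc s z)))
  / (2 * (lam s z - Cconj (lam s z))).
Definition Blam (s : skeleton) (z : C) : C :=
  (lam s z * (RtoC (pa s z) + lam s z * RtoC (pc s z))
     - (RtoC (pbt s z) + lam s z * RtoC (pdt s z)))
  / (2 * (lam s z - Cconj (lam s z))).
Definition Flam (s : skeleton) (z : C) : C :=
  / 2 * (RtoC (pf s z) + lam s z * RtoC (pg s z)).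

(* G1, G2 and A_lambda, B_lambda are the solutions of their defining linear
   conditions, which determine them since lambda is not real. *)
Lemma G12P (s : skeleton) (z : C) (g1 g2 : R) : Im (lam s z) <> 0%R ->
  lam_drift s z = RtoC g1 + RtoC g2 * lam s z <-> g1 = G1 s z /\ g2 = G2 s z.
Proof.
intros H; unfold G1, G2; destruct (lam_drift s z) as [p q];
  destruct (lam s z) as [l m]; unfold RtoC, Cplus, Cmult, Re, Im in *; cbn in *.
split.
- intros E; injection E; intros E2 E1.
  assert (Hg : g2 = (q / m)%R) by (rewrite E2; field; exact H).
  split; [rewrite <- Hg, E1; ring | exact Hg].
- intros [-> ->]; f_equal; field; exact H.
Qed.

Lemma ABlamP (s : skeleton) (z : C) (A B : C) : Im (lam s z) <> 0%R ->
  (forall U V : R,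
     A * (RtoC U + lam s z * RtoC V) + B * (RtoC U + Cconj (lam s z) * RtoC V)
     = / 2 * (RtoC (pa s z * U + pbt s z * V)
              + lam s z * RtoC (pc s z * U + pdt s z * V)))
  <-> A = Alam s z /\ B = Blam s z.
Proof.
intros H; unfold Alam, Blam.
generalize (pa s z) (pbt s z) (pc s z) (pdt s z); intros a b c d.
assert (Hl : lam s z - Cconj (lam s z) <> 0).
{ intros E; apply H; apply (f_equal Im) in E; revert E.
  destruct (lam s z); unfold Im, Cconj, Cminus, Cplus, Copp, RtoC; cbn; lra. }
revert Hl; generalize (Cconj (lam s z)); generalize (lam s z); intros l l' Hl.
assert (H2 : RtoC 2 <> 0) by (intros E; apply RtoC_inj in E; lra).
split.
- intros E; generalize (E 1%R 0%R) (E 0%R 1%R); rewrite !RtoC_plus, !RtoC_mult.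
  intros E1 E2.
  assert (K1 : A + B = / 2 * (RtoC a + l * RtoC c))
    by (transitivity (A * (1 + l * 0) + B * (1 + l' * 0));
        [ring | rewrite E1; ring]).
  assert (K2 : A * l + B * l' = / 2 * (RtoC b + l * RtoC d))
    by (transitivity (A * (0 + l * 1) + B * (0 + l' * 1));
        [ring | rewrite E2; ring]).
  assert (K3 : 2 * (A + B) = RtoC a + l * RtoC c) by (rewrite K1; field; exact H2).
  assert (K4 : 2 * (A * l + B * l') = RtoC b + l * RtoC d)
    by (rewrite K2; field; exact H2).
  rewrite <- K3, <- K4; split; field; repeat split; assumption.
- intros [-> ->] U V; rewrite !RtoC_plus, !RtoC_mult; field;
    repeat split; assumption.
Qed.

Definition pipeline (L : rsys) : bv :=
  let s := skeleton_of L in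
  Bv (pmu s) (fun z => (1 - pmu s z) * Alam s z)
     (fun z => (1 - pmu s z) * Blam s z) (fun z => (1 - pmu s z) * Flam s z).

(* w = U + lambda V with U = a22 u, V = v - a12 u. *)
Definition pipeline_unknown (s : skeleton) (V : C -> C) (z : C) : C :=
  RtoC (a22 s z * Re (V z)) + lam s z * RtoC (Im (V z) - a12 s z * Re (V z)).

Definition sysN (L : rsys) (z : C) : mat2 R := mmul (minv (sA1 L z)) (sA2 L z).
Definition sysP (L : rsys) (z : C) : mat2 R := mmul (minv (sA1 L z)) (sA0 L z).
Definition sysh (L : rsys) (z : C) : C := mapp (minv (sA1 L z)) (sk L z).

(* om is a C^1 nowhere-vanishing left eigenvector field of N for the eigenvalue
   l, which lies in the upper half-plane. *)
Definition eigenrow (Om : C -> Prop) (L : rsys) (l : C -> C) (om : C -> C * C) : Prop :=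
  isC1 Om (fun z => fst (om z)) /\ isC1 Om (fun z => snd (om z)) /\
  (forall z, Om z ->
     om z <> (RtoC 0, RtoC 0) /\ (0 < Im (l z))%R /\
     rowmul (om z) (toC (sysN L z)) = (l z * fst (om z), l z * snd (om z))).

Definition Xi (om : C -> C * C) (z : C) : mat2 C :=
  Mat2 (fst (om z)) (snd (om z)) (Cconj (fst (om z))) (Cconj (snd (om z))).

(* E_L(om), the eigenvalue l of om being an explicit argument. *)
Definition eigenpairing (L : rsys) (l : C -> C) (om : C -> C * C) : bv :=
  let row z :=
    (dx (fun p => fst (om p)) z + l z * dy (fun p => fst (om p)) z
       - fst (rowmul (om z) (toC (sysP L z))),
     dx (fun p => snd (om p)) z + l z * dy (fun p => snd (om p)) z
       - snd (rowmul (om z) (toC (sysP L z)))) in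
  let AB z := rowmul (row z) (Cminv (Xi om z)) in
  Bv (fun z => (l z - Ci) / (l z + Ci))
     (fun z => - (fst (AB z) / (1 - Ci * l z)))
     (fun z => - (snd (AB z) / (1 - Ci * l z)))
     (fun z => rowapp (om z) (sysh L z) / (1 - Ci * l z)).

Definition omega0 (s : skeleton) (l : C -> C) (z : C) : C * C :=
  (RtoC (a22 s z) - l z * RtoC (a12 s z), l z).

(* A map on BV data over all domains (depending only on the restriction of the
   datum to the domain), invariant under gauge and under pullback whenever the
   pullback is again a BV datum. *)
Definition invariant_assignment (T : Type) (I : (C -> Prop) -> bv -> T) : Prop :=
  (forall Om D D', plane_domain Om -> BV Om D -> BV Om D' -> bv_eq Om D D' ->
     I Om D = I Om D') /\
  (forall Om D phi, plane_domain Om -> BV Om D ->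
     isC1 Om phi -> (forall z, Om z -> phi z <> 0) ->
     I Om (gauge phi D) = I Om D) /\
  (forall Om' Om chi D, plane_domain Om' -> plane_domain Om -> or_diffeo Om' Om chi ->
     BV Om D -> BV Om' (pullback chi D) ->
     I Om' (pullback chi D) = I Om D).

(* Main.v *)
Require Import Defs.
From Stdlib Require Import Reals Lra.
From Coquelicot Require Import Coquelicot.

(** Call a datum [D] representing the real system [L] through a complex row field
    [om] if [w = om V] turns the complex residual of [D] into a complex
    combination, with coefficient row [rho], of the two real residuals of [L].
    The normal form represents [L] through [omega0]; a datum represents its own
    realification through [(1, i)]; and this relation is carried along by left
    multiplication ([rho] changes), substitution ([om] becomes [om S]) and
    coordinate change ([om] and [D] are pulled back).

    Two data representing the same elliptic system are gauge equivalent: the real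
    quadratic [det (A2 - l A1)] has a single root in the upper half-plane, with a
    one-dimensional left kernel, so both data have the same [mu] and their rows
    differ by a complex factor [phi]; comparing zeroth order terms then gives the
    gauge formula.  For the substitution [S = (phi, psi)] the factor is the
    quotient of the second entries [l] of [omega0] and [i (phi - psi)] of
    [(1, i) S]. *)

Local Open Scope R_scope.

(** * Partial derivatives of real functions on an open set *)

(** The sign of det S never enters the mechanism: ellipticity only says that the determinant conic
    has no real zeros, which bounds its discriminant whatever the sign of [a11], and a representing
    row only has to be real-linearly invertible, a condition that det S rescales. A negative
    determinant shows up solely in the sign of [a11]. What shapes the proof is regularity. Left
    multipliers are merely continuous, so [rho] is chosen point by point and skeletons are compared
    directly. A system whose skeleton is regular may itself have rough coefficients, so
    substitutions are carried out on its skeleton. A C^1 diffeomorphism makes the pulled-back mu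
    visibly continuous only; that it is C^1 is read off from the skeleton of the transformed system,
    by uniqueness of mu. Finally, [isC1R] records partial derivatives only, so total
    differentiability has to be derived before any chain rule. *)

Lemma continuous_Re (z : C) : continuous (fun p : C => Re p) z.
Proof. destruct z as [x y]; apply (continuous_fst x y). Qed.

Lemma continuous_Im (z : C) : continuous (fun p : C => Im p) z.
Proof. destruct z as [x y]; apply (continuous_snd x y). Qed.

Lemma continuous_C (f : C -> C) (z : C) :
  continuous f z <->
  continuous (fun p => Re (f p)) z /\ continuous (fun p => Im (f p)) z.
Proof.
split.
- intros H; split.
  + apply (continuous_comp f (fun p => Re p) z H), continuous_Re.
  + apply (continuous_comp f (fun p => Im p) z H), continuous_Im.
- intros [H1 H2].
  apply (continuous_ext (fun p => (Re (f p), Im (f p)) : C)).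
  { intros p; symmetry; apply surjective_pairing. }
  apply (continuous_comp_2 (fun p => Re (f p)) (fun p => Im (f p))
           (fun a b => (a, b) : C)); trivial.
  apply (continuous_ext (fun p : R * R => p)); [intros []; trivial|].
  apply continuous_id.
Qed.

(** Values off [Om] are arbitrary, so only equality on [Om] is ever available; openness turns it
    into equality near each point, which is what limits and derivatives see. *)
Lemma near_ext (A : Type) (Om : C -> Prop) (f g : C -> A) (z : C) :
  open Om -> (forall p, Om p -> f p = g p) -> Om z ->
  locally z (fun p => f p = g p).
Proof.
intros Ho E Hz; generalize (Ho z Hz); apply filter_imp, E.
Qed.

Lemma near_x (P : C -> Prop) (z : C) :
  locally z P -> locally (Re z) (fun t => P (t, Im z)).
Proof.
intros [e H]; exists e; intros t Ht; apply H; split; [exact Ht|apply ball_center].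
Qed.

Lemma near_y (P : C -> Prop) (z : C) :
  locally z P -> locally (Im z) (fun t => P (Re z, t)).
Proof.
intros [e H]; exists e; intros t Ht; apply H; split; [apply ball_center|exact Ht].
Qed.

Lemma dxR_near (f g : C -> R) (z : C) :
  locally z (fun p => f p = g p) -> dxR f z = dxR g z.
Proof. intros H; apply Derive_ext_loc, (near_x _ _ H). Qed.

Lemma dyR_near (f g : C -> R) (z : C) :
  locally z (fun p => f p = g p) -> dyR f z = dyR g z.
Proof. intros H; apply Derive_ext_loc, (near_y _ _ H). Qed.

Lemma isC0R_ext (Om : C -> Prop) (f g : C -> R) :
  open Om -> (forall z, Om z -> f z = g z) -> isC0R Om f -> isC0R Om g.
Proof.
intros Ho E H z Hz; apply (continuous_ext_loc g f z).
- apply (near_ext R Om); trivial.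
- apply H, Hz.
Qed.

Lemma isC1R_ext (Om : C -> Prop) (f g : C -> R) :
  open Om -> (forall z, Om z -> f z = g z) -> isC1R Om f -> isC1R Om g.
Proof.
intros Ho E H z Hz; destruct (H z Hz) as (Hx & Hy & Cx & Cy).
assert (N : forall p, Om p -> locally p (fun p => f p = g p))
  by (intros p Hp; apply (near_ext R Om); trivial).
assert (Ez : (Re z, Im z) = z) by (symmetry; apply surjective_pairing).
repeat split.
- apply (ex_derive_ext_loc _ _ _ (near_x _ _ (N z Hz)) Hx).
- apply (ex_derive_ext_loc _ _ _ (near_y _ _ (N z Hz)) Hy).
- apply (continuous_ext_loc (dxR g) (dxR f) z); trivial.
  apply (near_ext R Om); trivial; intros p Hp; apply dxR_near, N, Hp.
- apply (continuous_ext_loc (dyR g) (dyR f) z); trivial.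
  apply (near_ext R Om); trivial; intros p Hp; apply dyR_near, N, Hp.
Qed.

Lemma dxR_ext (Om : C -> Prop) (f g : C -> R) (z : C) :
  open Om -> (forall p, Om p -> f p = g p) -> Om z -> dxR f z = dxR g z.
Proof. intros Ho E Hz; apply dxR_near, (near_ext R Om); trivial. Qed.

Lemma dyR_ext (Om : C -> Prop) (f g : C -> R) (z : C) :
  open Om -> (forall p, Om p -> f p = g p) -> Om z -> dyR f z = dyR g z.
Proof. intros Ho E Hz; apply dyR_near, (near_ext R Om); trivial. Qed.

(** An x-partial that exists on a neighbourhood and is continuous at the point, together with a
    y-partial at the point, already yields the total derivative. *)
Lemma C1R_differentiable (Om : C -> Prop) (f : C -> R) (z : C) :
  open Om -> isC1R Om f -> Om z ->
  differentiable_pt_lim (fun x y => f (x, y)) (Re z) (Im z) (dxR f z) (dyR f z).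
Proof.
intros Ho H Hz; apply filterdiff_differentiable_pt_lim.
destruct (H z Hz) as (_ & Hy & Cx & _).
destruct z as [x y].
apply (is_derive_filterdiff (fun a b => f (a, b)) x y
         (fun a b => dxR f (a, b)) (dyR f (x, y))).
- generalize (Ho _ Hz); apply filter_imp; intros [a b] Hab.
  apply Derive_correct, (H _ Hab).
- apply Derive_correct, Hy.
- apply (continuous_ext (dxR f)); [intros []; trivial | exact Cx].
Qed.

(** Partial derivatives existing separately would not give continuity; total differentiability
    does. *)
Lemma C1R_C0R (Om : C -> Prop) (f : C -> R) :
  open Om -> isC1R Om f -> isC0R Om f.
Proof.
intros Ho H z Hz; generalize (C1R_differentiable _ _ _ Ho H Hz).
intros D; apply filterdiff_differentiable_pt_lim in D.
assert (E := filterdiff_continuous _ _ (ex_intro _ _ D)).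
destruct z as [x y].
apply (continuous_ext (fun u : R * R => f (fst u, snd u)));
  [intros []; trivial | exact E].
Qed.

Lemma isC0R_const (Om : C -> Prop) (c : R) : isC0R Om (fun _ => c).
Proof. intros z _; apply continuous_const. Qed.

Lemma isC0R_plus (Om : C -> Prop) (f g : C -> R) :
  isC0R Om f -> isC0R Om g -> isC0R Om (fun z => f z + g z).
Proof. intros H K z Hz; apply (continuous_plus f g); auto. Qed.

Lemma isC0R_mult (Om : C -> Prop) (f g : C -> R) :
  isC0R Om f -> isC0R Om g -> isC0R Om (fun z => f z * g z).
Proof. intros H K z Hz; apply (continuous_mult f g); auto. Qed.

Lemma isC0R_opp (Om : C -> Prop) (f : C -> R) :
  isC0R Om f -> isC0R Om (fun z => - f z).
Proof. intros H z Hz; apply (continuous_opp f); auto. Qed.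

Lemma isC0R_minus (Om : C -> Prop) (f g : C -> R) :
  isC0R Om f -> isC0R Om g -> isC0R Om (fun z => f z - g z).
Proof. intros H K; apply isC0R_plus, isC0R_opp; trivial. Qed.

Lemma isC0R_inv (Om : C -> Prop) (f : C -> R) :
  isC0R Om f -> (forall z, Om z -> f z <> 0) -> isC0R Om (fun z => / f z).
Proof.
intros H K z Hz; apply (continuous_comp f Rinv); auto.
apply continuity_pt_filterlim, continuity_pt_inv; auto.
apply derivable_continuous_pt, derivable_pt_id.
Qed.

Lemma isC0R_sqrt (Om : C -> Prop) (f : C -> R) :
  isC0R Om f -> (forall z, Om z -> 0 < f z) -> isC0R Om (fun z => sqrt (f z)).
Proof.
intros H K z Hz; apply (continuous_comp f sqrt); auto.
apply continuity_pt_filterlim, continuity_pt_sqrt, Rlt_le; auto.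
Qed.

Lemma isC0R_div (Om : C -> Prop) (f g : C -> R) :
  isC0R Om f -> isC0R Om g -> (forall z, Om z -> g z <> 0) ->
  isC0R Om (fun z => f z / g z).
Proof. intros H K N; apply isC0R_mult, isC0R_inv; trivial. Qed.

Lemma isC1R_const (Om : C -> Prop) (c : R) : isC1R Om (fun _ => c).
Proof.
intros z _; repeat split; try apply ex_derive_const.
- apply (continuous_ext (fun _ => 0)); [|apply continuous_const].
  intros p; symmetry; apply (Derive_const c).
- apply (continuous_ext (fun _ => 0)); [|apply continuous_const].
  intros p; symmetry; apply (Derive_const c).
Qed.

Section C1.
Variable Om : C -> Prop.
Hypothesis Ho : open Om.

(** Candidate partials given through [is_derive] prove existence and at the same time identify
    [dxR f], [dyR f] with functions known to be continuous. The real closure rules below rest on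
    this. *)
Lemma isC1R_build (f gx gy : C -> R) :
  (forall z, Om z -> is_derive (fun t => f (t, Im z)) (Re z) (gx z) /\
                     is_derive (fun t => f (Re z, t)) (Im z) (gy z)) ->
  isC0R Om gx -> isC0R Om gy -> isC1R Om f.
Proof.
intros H Cx Cy z Hz; destruct (H z Hz) as [Hx Hy]; repeat split.
- exists (gx z); exact Hx.
- exists (gy z); exact Hy.
- apply (isC0R_ext Om gx); trivial.
  intros p Hp; symmetry; apply is_derive_unique, H, Hp.
- apply (isC0R_ext Om gy); trivial.
  intros p Hp; symmetry; apply is_derive_unique, H, Hp.
Qed.

Lemma isC1R_dx (f : C -> R) (z : C) : isC1R Om f -> Om z ->
  is_derive (fun t => f (t, Im z)) (Re z) (dxR f z).
Proof. intros H Hz; apply Derive_correct, (H z Hz). Qed.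

Lemma isC1R_dy (f : C -> R) (z : C) : isC1R Om f -> Om z ->
  is_derive (fun t => f (Re z, t)) (Im z) (dyR f z).
Proof. intros H Hz; apply Derive_correct, (H z Hz). Qed.

Lemma isC1R_dxC0 (f : C -> R) : isC1R Om f -> isC0R Om (dxR f).
Proof. intros H z Hz; apply (H z Hz). Qed.

Lemma isC1R_dyC0 (f : C -> R) : isC1R Om f -> isC0R Om (dyR f).
Proof. intros H z Hz; apply (H z Hz). Qed.

Lemma dxR_plus (f g : C -> R) (z : C) : isC1R Om f -> isC1R Om g -> Om z ->
  dxR (fun p => f p + g p) z = dxR f z + dxR g z.
Proof. intros H K Hz; apply Derive_plus; [apply (H z Hz)|apply (K z Hz)]. Qed.

Lemma dyR_plus (f g : C -> R) (z : C) : isC1R Om f -> isC1R Om g -> Om z ->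
  dyR (fun p => f p + g p) z = dyR f z + dyR g z.
Proof. intros H K Hz; apply Derive_plus; [apply (H z Hz)|apply (K z Hz)]. Qed.

Lemma dxR_minus (f g : C -> R) (z : C) : isC1R Om f -> isC1R Om g -> Om z ->
  dxR (fun p => f p - g p) z = dxR f z - dxR g z.
Proof. intros H K Hz; apply Derive_minus; [apply (H z Hz)|apply (K z Hz)]. Qed.

Lemma dyR_minus (f g : C -> R) (z : C) : isC1R Om f -> isC1R Om g -> Om z ->
  dyR (fun p => f p - g p) z = dyR f z - dyR g z.
Proof. intros H K Hz; apply Derive_minus; [apply (H z Hz)|apply (K z Hz)]. Qed.

Lemma dxR_mult (f g : C -> R) (z : C) : isC1R Om f -> isC1R Om g -> Om z ->
  dxR (fun p => f p * g p) z = dxR f z * g z + f z * dxR g z.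
Proof.
intros H K Hz; unfold dxR; rewrite Derive_mult; [|apply (H z Hz)|apply (K z Hz)].
destruct z; reflexivity.
Qed.

Lemma dyR_mult (f g : C -> R) (z : C) : isC1R Om f -> isC1R Om g -> Om z ->
  dyR (fun p => f p * g p) z = dyR f z * g z + f z * dyR g z.
Proof.
intros H K Hz; unfold dyR; rewrite Derive_mult; [|apply (H z Hz)|apply (K z Hz)].
destruct z; reflexivity.
Qed.

Lemma isC1R_plus (f g : C -> R) :
  isC1R Om f -> isC1R Om g -> isC1R Om (fun z => f z + g z).
Proof.
intros H K; apply (isC1R_build _ (fun z => dxR f z + dxR g z)
                                 (fun z => dyR f z + dyR g z)).
- intros z Hz; split.
  + apply (is_derive_plus (fun t => f (t, Im z))); apply isC1R_dx; trivial.
  + apply (is_derive_plus (fun t => f (Re z, t))); apply isC1R_dy; trivial.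
- apply isC0R_plus; apply isC1R_dxC0; trivial.
- apply isC0R_plus; apply isC1R_dyC0; trivial.
Qed.

Lemma isC1R_opp (f : C -> R) : isC1R Om f -> isC1R Om (fun z => - f z).
Proof.
intros H; apply (isC1R_build _ (fun z => - dxR f z) (fun z => - dyR f z)).
- intros z Hz; split.
  + apply (is_derive_opp (fun t => f (t, Im z))), isC1R_dx; trivial.
  + apply (is_derive_opp (fun t => f (Re z, t))), isC1R_dy; trivial.
- apply isC0R_opp, isC1R_dxC0, H.
- apply isC0R_opp, isC1R_dyC0, H.
Qed.

Lemma isC1R_minus (f g : C -> R) :
  isC1R Om f -> isC1R Om g -> isC1R Om (fun z => f z - g z).
Proof. intros H K; apply isC1R_plus, isC1R_opp; trivial. Qed.

Lemma isC1R_mult (f g : C -> R) :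
  isC1R Om f -> isC1R Om g -> isC1R Om (fun z => f z * g z).
Proof.
intros H K; apply (isC1R_build _ (fun z => dxR f z * g z + f z * dxR g z)
                                 (fun z => dyR f z * g z + f z * dyR g z)).
- intros z Hz; split.
  + rewrite <- (dxR_mult f g z H K Hz); apply Derive_correct, ex_derive_mult;
      [apply (H z Hz)|apply (K z Hz)].
  + rewrite <- (dyR_mult f g z H K Hz); apply Derive_correct, ex_derive_mult;
      [apply (H z Hz)|apply (K z Hz)].
- apply isC0R_plus; apply isC0R_mult;
    try (apply isC1R_dxC0; trivial); apply C1R_C0R; trivial.
- apply isC0R_plus; apply isC0R_mult;
    try (apply isC1R_dyC0; trivial); apply C1R_C0R; trivial.
Qed.

Lemma isC1R_inv (f : C -> R) :
  isC1R Om f -> (forall z, Om z -> f z <> 0) -> isC1R Om (fun z => / f z).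
Proof.
intros H N; apply (isC1R_build _ (fun z => - dxR f z / (f z) ^ 2)
                                 (fun z => - dyR f z / (f z) ^ 2)).
- intros [x y] Hz; split.
  + apply (is_derive_inv (fun t => f (t, y)) x); [|apply N, Hz].
    apply (isC1R_dx _ _ H Hz).
  + apply (is_derive_inv (fun t => f (x, t)) y); [|apply N, Hz].
    apply (isC1R_dy _ _ H Hz).
- apply isC0R_div; [apply isC0R_opp, isC1R_dxC0, H| |].
  (* [x ^ 2] unfolds to [x * (x * 1)]: two products and a constant. *)
  + apply isC0R_mult; [|apply isC0R_mult]; try apply isC0R_const;
      apply C1R_C0R; trivial.
  + intros z Hz; apply pow_nonzero, N, Hz.
- apply isC0R_div; [apply isC0R_opp, isC1R_dyC0, H| |].
  + apply isC0R_mult; [|apply isC0R_mult]; try apply isC0R_const;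
      apply C1R_C0R; trivial.
  + intros z Hz; apply pow_nonzero, N, Hz.
Qed.

Lemma isC1R_div (f g : C -> R) :
  isC1R Om f -> isC1R Om g -> (forall z, Om z -> g z <> 0) ->
  isC1R Om (fun z => f z / g z).
Proof. intros H K N; apply isC1R_mult, isC1R_inv; trivial. Qed.

Lemma isC1R_sqrt (f : C -> R) :
  isC1R Om f -> (forall z, Om z -> 0 < f z) -> isC1R Om (fun z => sqrt (f z)).
Proof.
intros H N; apply (isC1R_build _ (fun z => dxR f z / (2 * sqrt (f z)))
                                 (fun z => dyR f z / (2 * sqrt (f z)))).
- intros [x y] Hz; split.
  + apply (is_derive_sqrt (fun t => f (t, y)) x); [|apply N, Hz].
    apply (isC1R_dx _ _ H Hz).
  + apply (is_derive_sqrt (fun t => f (x, t)) y); [|apply N, Hz].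
    apply (isC1R_dy _ _ H Hz).
- apply isC0R_div; [apply isC1R_dxC0, H| |].
  + apply isC0R_mult; [apply isC0R_const|apply isC0R_sqrt; trivial].
    apply C1R_C0R; trivial.
  + intros z Hz; apply Rgt_not_eq, Rmult_lt_0_compat; [lra|apply sqrt_lt_R0, N, Hz].
- apply isC0R_div; [apply isC1R_dyC0, H| |].
  + apply isC0R_mult; [apply isC0R_const|apply isC0R_sqrt; trivial].
    apply C1R_C0R; trivial.
  + intros z Hz; apply Rgt_not_eq, Rmult_lt_0_compat; [lra|apply sqrt_lt_R0, N, Hz].
Qed.

End C1.

(** * Chain rule for C^1 functions on plane domains *)

Lemma is_derive_comp_C1R (Om : C -> Prop) (f : C -> R) (c : R -> C) (t a b : R) :
  open Om -> isC1R Om f -> Om (c t) ->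
  is_derive (fun s => Re (c s)) t a -> is_derive (fun s => Im (c s)) t b ->
  is_derive (fun s => f (c s)) t (dxR f (c t) * a + dyR f (c t) * b).
Proof.
intros Ho H Ht Ha Hb.
apply (is_derive_ext (fun s => f (Re (c s), Im (c s)))).
{ intros s; rewrite <- surjective_pairing; trivial. }
apply is_derive_Reals.
apply (derivable_pt_lim_comp_2d (fun x y => f (x, y))).
- apply (C1R_differentiable Om); trivial.
- apply is_derive_Reals, Ha.
- apply is_derive_Reals, Hb.
Qed.

Section Chain.
Variables (Om' Om : C -> Prop) (chi : C -> C).
Hypotheses (Ho' : open Om') (Ho : open Om) (Hchi : isC1 Om' chi)
  (Hmap : forall z, Om' z -> Om (chi z)).

Lemma is_derive_dx_comp (f : C -> R) (z : C) : isC1R Om f -> Om' z ->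
  is_derive (fun t => f (chi (t, Im z))) (Re z)
    (dxR f (chi z) * Re (dx chi z) + dyR f (chi z) * Im (dx chi z)).
Proof.
intros H Hz; destruct z as [x y].
apply (is_derive_comp_C1R Om f (fun t => chi (t, y)) x); trivial.
- apply Hmap, Hz.
- apply (isC1R_dx Om' _ _ (proj1 Hchi) Hz).
- apply (isC1R_dx Om' _ _ (proj2 Hchi) Hz).
Qed.

Lemma is_derive_dy_comp (f : C -> R) (z : C) : isC1R Om f -> Om' z ->
  is_derive (fun t => f (chi (Re z, t))) (Im z)
    (dxR f (chi z) * Re (dy chi z) + dyR f (chi z) * Im (dy chi z)).
Proof.
intros H Hz; destruct z as [x y].
apply (is_derive_comp_C1R Om f (fun t => chi (x, t)) y); trivial.
- apply Hmap, Hz.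
- apply (isC1R_dy Om' _ _ (proj1 Hchi) Hz).
- apply (isC1R_dy Om' _ _ (proj2 Hchi) Hz).
Qed.

Lemma dxR_comp (f : C -> R) (z : C) : isC1R Om f -> Om' z ->
  dxR (fun p => f (chi p)) z
  = dxR f (chi z) * Re (dx chi z) + dyR f (chi z) * Im (dx chi z).
Proof. intros H Hz; apply is_derive_unique, is_derive_dx_comp; trivial. Qed.

Lemma dyR_comp (f : C -> R) (z : C) : isC1R Om f -> Om' z ->
  dyR (fun p => f (chi p)) z
  = dxR f (chi z) * Re (dy chi z) + dyR f (chi z) * Im (dy chi z).
Proof. intros H Hz; apply is_derive_unique, is_derive_dy_comp; trivial. Qed.

Lemma chi_C0 : isC0 Om' chi.
Proof.
intros z Hz; apply continuous_C; split.
- apply (C1R_C0R Om' _ Ho' (proj1 Hchi) z Hz).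
- apply (C1R_C0R Om' _ Ho' (proj2 Hchi) z Hz).
Qed.

Lemma isC0R_comp (f : C -> R) : isC0R Om f -> isC0R Om' (fun z => f (chi z)).
Proof.
intros H z Hz; apply (continuous_comp chi f); [apply chi_C0, Hz|apply H, Hmap, Hz].
Qed.

Lemma isC1R_comp (f : C -> R) : isC1R Om f -> isC1R Om' (fun z => f (chi z)).
Proof.
intros H; apply (isC1R_build Om' Ho' _
  (fun z => dxR f (chi z) * Re (dx chi z) + dyR f (chi z) * Im (dx chi z))
  (fun z => dxR f (chi z) * Re (dy chi z) + dyR f (chi z) * Im (dy chi z))).
- intros z Hz; split; [apply is_derive_dx_comp|apply is_derive_dy_comp]; trivial.
- apply isC0R_plus; apply isC0R_mult.
  + apply isC0R_comp, isC1R_dxC0, H.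
  + apply (isC1R_dxC0 Om' _ (proj1 Hchi)).
  + apply isC0R_comp, isC1R_dyC0, H.
  + apply (isC1R_dxC0 Om' _ (proj2 Hchi)).
- apply isC0R_plus; apply isC0R_mult.
  + apply isC0R_comp, isC1R_dxC0, H.
  + apply (isC1R_dyC0 Om' _ (proj1 Hchi)).
  + apply isC0R_comp, isC1R_dyC0, H.
  + apply (isC1R_dyC0 Om' _ (proj2 Hchi)).
Qed.

End Chain.

(** * Complex-valued functions *)

Lemma C_ext (a b : C) : Re a = Re b -> Im a = Im b -> a = b.
Proof. destruct a, b; cbn; intros -> ->; trivial. Qed.

Lemma isC0_C0R (Om : C -> Prop) (f : C -> C) :
  isC0 Om f <-> isC0R Om (fun z => Re (f z)) /\ isC0R Om (fun z => Im (f z)).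
Proof.
split.
- intros H; split; intros z Hz; apply (proj1 (continuous_C f z)), H, Hz.
- intros [H K] z Hz; apply continuous_C; split; [apply H, Hz|apply K, Hz].
Qed.

Lemma isC0_RtoC (Om : C -> Prop) (f : C -> R) :
  isC0R Om f -> isC0 Om (fun z => RtoC (f z)).
Proof.
intros H; apply isC0_C0R; split; [exact H | apply (isC0R_const Om 0)].
Qed.

Lemma isC0_const (Om : C -> Prop) (c : C) : isC0 Om (fun _ => c).
Proof. intros z _; apply continuous_const. Qed.

Lemma isC0_plus (Om : C -> Prop) (f g : C -> C) :
  isC0 Om f -> isC0 Om g -> isC0 Om (fun z => f z + g z)%C.
Proof.
rewrite !isC0_C0R; intros [H1 H2] [K1 K2]; split;
  [apply (isC0R_plus _ _ _ H1 K1)|apply (isC0R_plus _ _ _ H2 K2)].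
Qed.

Lemma isC0_opp (Om : C -> Prop) (f : C -> C) :
  isC0 Om f -> isC0 Om (fun z => - f z)%C.
Proof.
rewrite !isC0_C0R; intros [H1 H2]; split;
  [apply (isC0R_opp _ _ H1)|apply (isC0R_opp _ _ H2)].
Qed.

Lemma isC0_minus (Om : C -> Prop) (f g : C -> C) :
  isC0 Om f -> isC0 Om g -> isC0 Om (fun z => f z - g z)%C.
Proof. intros H K; apply isC0_plus, isC0_opp; trivial. Qed.

Lemma isC0_mult (Om : C -> Prop) (f g : C -> C) :
  isC0 Om f -> isC0 Om g -> isC0 Om (fun z => f z * g z)%C.
Proof.
rewrite !isC0_C0R; intros [H1 H2] [K1 K2]; split.
- apply (isC0R_minus _ _ _ (isC0R_mult _ _ _ H1 K1) (isC0R_mult _ _ _ H2 K2)).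
- apply (isC0R_plus _ _ _ (isC0R_mult _ _ _ H1 K2) (isC0R_mult _ _ _ H2 K1)).
Qed.

(** This sum of squares is the denominator in the definition of [Cinv]. *)
Lemma Csqnorm_neq_0 (w : C) : w <> 0%C -> Re w ^ 2 + Im w ^ 2 <> 0.
Proof.
intros H E; apply H, C_ext; cbn; nra.
Qed.

Lemma isC0_inv (Om : C -> Prop) (f : C -> C) :
  isC0 Om f -> (forall z, Om z -> f z <> 0%C) -> isC0 Om (fun z => / f z)%C.
Proof.
rewrite !isC0_C0R; intros [H1 H2] N.
assert (Q : isC0R Om (fun z => Re (f z) ^ 2 + Im (f z) ^ 2)).
{ apply isC0R_plus; apply isC0R_mult; trivial; apply isC0R_mult; trivial;
    apply isC0R_const. }
split.
- apply (isC0R_div _ _ _ H1 Q); intros z Hz; apply Csqnorm_neq_0, N, Hz.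
- apply (isC0R_div _ _ _ (isC0R_opp _ _ H2) Q).
  intros z Hz; apply Csqnorm_neq_0, N, Hz.
Qed.

Lemma isC0_div (Om : C -> Prop) (f g : C -> C) :
  isC0 Om f -> isC0 Om g -> (forall z, Om z -> g z <> 0%C) ->
  isC0 Om (fun z => f z / g z)%C.
Proof. intros H K N; apply isC0_mult, isC0_inv; trivial. Qed.

Lemma isC0_conj (Om : C -> Prop) (f : C -> C) :
  isC0 Om f -> isC0 Om (fun z => Cconj (f z)).
Proof.
rewrite !isC0_C0R; intros [H1 H2]; split;
  [exact H1|apply (isC0R_opp _ _ H2)].
Qed.

Lemma isC1_ext (Om : C -> Prop) (f g : C -> C) :
  open Om -> (forall z, Om z -> f z = g z) -> isC1 Om f -> isC1 Om g.
Proof.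
intros Ho E [H K]; split.
- apply (isC1R_ext Om (fun p => Re (f p))); trivial.
  intros z Hz; rewrite E; trivial.
- apply (isC1R_ext Om (fun p => Im (f p))); trivial.
  intros z Hz; rewrite E; trivial.
Qed.

Lemma dx_ext (Om : C -> Prop) (f g : C -> C) (z : C) :
  open Om -> (forall p, Om p -> f p = g p) -> Om z -> dx f z = dx g z.
Proof.
intros Ho E Hz; unfold dx; f_equal; apply (dxR_ext Om); trivial;
  intros p Hp; rewrite E; trivial.
Qed.

Lemma dy_ext (Om : C -> Prop) (f g : C -> C) (z : C) :
  open Om -> (forall p, Om p -> f p = g p) -> Om z -> dy f z = dy g z.
Proof.
intros Ho E Hz; unfold dy; f_equal; apply (dyR_ext Om); trivial;
  intros p Hp; rewrite E; trivial.
Qed.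

Lemma isC1_const (Om : C -> Prop) (c : C) : isC1 Om (fun _ => c).
Proof. split; apply isC1R_const. Qed.

Lemma isC1_RtoC (Om : C -> Prop) (f : C -> R) :
  isC1R Om f -> isC1 Om (fun z => RtoC (f z)).
Proof. intros H; split; [exact H | apply (isC1R_const Om 0)]. Qed.

Lemma dx_RtoC (f : C -> R) (z : C) : dx (fun p => RtoC (f p)) z = RtoC (dxR f z).
Proof. apply C_ext; [reflexivity|apply (Derive_const 0)]. Qed.

Lemma dy_RtoC (f : C -> R) (z : C) : dy (fun p => RtoC (f p)) z = RtoC (dyR f z).
Proof. apply C_ext; [reflexivity|apply (Derive_const 0)]. Qed.

Section ComplexC1.
Variable Om : C -> Prop.
Hypothesis Ho : open Om.

Lemma isC1_C0 (f : C -> C) : isC1 Om f -> isC0 Om f.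
Proof.
intros [H K]; apply isC0_C0R; split; apply C1R_C0R; trivial.
Qed.

Lemma isC1_dxC0 (f : C -> C) : isC1 Om f -> isC0 Om (dx f).
Proof.
intros [H K]; apply isC0_C0R; split;
  [apply (isC1R_dxC0 _ _ H)|apply (isC1R_dxC0 _ _ K)].
Qed.

Lemma isC1_dyC0 (f : C -> C) : isC1 Om f -> isC0 Om (dy f).
Proof.
intros [H K]; apply isC0_C0R; split;
  [apply (isC1R_dyC0 _ _ H)|apply (isC1R_dyC0 _ _ K)].
Qed.

Lemma isC1_plus (f g : C -> C) :
  isC1 Om f -> isC1 Om g -> isC1 Om (fun z => f z + g z)%C.
Proof.
intros [H1 H2] [K1 K2]; split;
  [apply (isC1R_plus _ Ho _ _ H1 K1)|apply (isC1R_plus _ Ho _ _ H2 K2)].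
Qed.

Lemma isC1_opp (f : C -> C) : isC1 Om f -> isC1 Om (fun z => - f z)%C.
Proof.
intros [H1 H2]; split;
  [apply (isC1R_opp _ Ho _ H1)|apply (isC1R_opp _ Ho _ H2)].
Qed.

Lemma isC1_minus (f g : C -> C) :
  isC1 Om f -> isC1 Om g -> isC1 Om (fun z => f z - g z)%C.
Proof. intros H K; apply isC1_plus, isC1_opp; trivial. Qed.

Lemma isC1_mult (f g : C -> C) :
  isC1 Om f -> isC1 Om g -> isC1 Om (fun z => f z * g z)%C.
Proof.
intros [H1 H2] [K1 K2]; split.
- apply (isC1R_minus _ Ho _ _ (isC1R_mult _ Ho _ _ H1 K1) (isC1R_mult _ Ho _ _ H2 K2)).
- apply (isC1R_plus _ Ho _ _ (isC1R_mult _ Ho _ _ H1 K2) (isC1R_mult _ Ho _ _ H2 K1)).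
Qed.

Lemma isC1_inv (f : C -> C) :
  isC1 Om f -> (forall z, Om z -> f z <> 0%C) -> isC1 Om (fun z => / f z)%C.
Proof.
intros [H1 H2] N.
assert (Q : isC1R Om (fun z => Re (f z) ^ 2 + Im (f z) ^ 2)).
{ apply isC1R_plus; trivial; apply isC1R_mult; trivial; apply isC1R_mult; trivial;
    apply isC1R_const. }
split.
- apply (isC1R_div _ Ho _ _ H1 Q); intros z Hz; apply Csqnorm_neq_0, N, Hz.
- apply (isC1R_div _ Ho _ _ (isC1R_opp _ Ho _ H2) Q).
  intros z Hz; apply Csqnorm_neq_0, N, Hz.
Qed.

Lemma isC1_div (f g : C -> C) :
  isC1 Om f -> isC1 Om g -> (forall z, Om z -> g z <> 0%C) ->
  isC1 Om (fun z => f z / g z)%C.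
Proof. intros H K N; apply isC1_mult, isC1_inv; trivial. Qed.

Variables (f g : C -> C) (z : C).
Hypotheses (Hf : isC1 Om f) (Hg : isC1 Om g) (Hz : Om z).

Lemma dx_plus : dx (fun p => f p + g p)%C z = (dx f z + dx g z)%C.
Proof.
destruct Hf, Hg; apply C_ext; cbn; apply (dxR_plus Om); trivial.
Qed.

Lemma dy_plus : dy (fun p => f p + g p)%C z = (dy f z + dy g z)%C.
Proof.
destruct Hf, Hg; apply C_ext; cbn; apply (dyR_plus Om); trivial.
Qed.

Lemma dx_minus : dx (fun p => f p - g p)%C z = (dx f z - dx g z)%C.
Proof.
destruct Hf, Hg; apply C_ext; cbn.
- apply (dxR_minus Om (fun p => Re (f p)) (fun p => Re (g p))); trivial.
- apply (dxR_minus Om (fun p => Im (f p)) (fun p => Im (g p))); trivial.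
Qed.

Lemma dy_minus : dy (fun p => f p - g p)%C z = (dy f z - dy g z)%C.
Proof.
destruct Hf, Hg; apply C_ext; cbn.
- apply (dyR_minus Om (fun p => Re (f p)) (fun p => Re (g p))); trivial.
- apply (dyR_minus Om (fun p => Im (f p)) (fun p => Im (g p))); trivial.
Qed.

Lemma dx_mult : dx (fun p => f p * g p)%C z = (dx f z * g z + f z * dx g z)%C.
Proof.
destruct Hf as [F1 F2], Hg as [K1 K2]; apply C_ext; cbn.
- rewrite (dxR_minus Om (fun p => Re (f p) * Re (g p)) (fun p => Im (f p) * Im (g p)));
    try apply isC1R_mult; trivial.
  rewrite !(dxR_mult Om) by trivial; unfold Re, Im; ring.
- rewrite (dxR_plus Om (fun p => Re (f p) * Im (g p)) (fun p => Im (f p) * Re (g p)));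
    try apply isC1R_mult; trivial.
  rewrite !(dxR_mult Om) by trivial; unfold Re, Im; ring.
Qed.

Lemma dy_mult : dy (fun p => f p * g p)%C z = (dy f z * g z + f z * dy g z)%C.
Proof.
destruct Hf as [F1 F2], Hg as [K1 K2]; apply C_ext; cbn.
- rewrite (dyR_minus Om (fun p => Re (f p) * Re (g p)) (fun p => Im (f p) * Im (g p)));
    try apply isC1R_mult; trivial.
  rewrite !(dyR_mult Om) by trivial; unfold Re, Im; ring.
- rewrite (dyR_plus Om (fun p => Re (f p) * Im (g p)) (fun p => Im (f p) * Re (g p)));
    try apply isC1R_mult; trivial.
  rewrite !(dyR_mult Om) by trivial; unfold Re, Im; ring.
Qed.

End ComplexC1.

Section ComplexChain.
Variables (Om' Om : C -> Prop) (chi : C -> C).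
Hypotheses (Ho' : open Om') (Ho : open Om) (Hchi : isC1 Om' chi)
  (Hmap : forall z, Om' z -> Om (chi z)).

Lemma isC1_comp (f : C -> C) : isC1 Om f -> isC1 Om' (fun z => f (chi z)).
Proof.
intros [H K]; split; [apply (isC1R_comp Om' Om chi Ho' Ho Hchi Hmap _ H)
                     |apply (isC1R_comp Om' Om chi Ho' Ho Hchi Hmap _ K)].
Qed.

Lemma isC0_comp (f : C -> C) : isC0 Om f -> isC0 Om' (fun z => f (chi z)).
Proof.
intros H z Hz; apply (continuous_comp chi f).
- apply (isC1_C0 Om' Ho' chi Hchi z Hz).
- apply H, Hmap, Hz.
Qed.

Lemma dx_comp (f : C -> C) (z : C) : isC1 Om f -> Om' z ->
  dx (fun p => f (chi p)) z
  = (dx f (chi z) * RtoC (Re (dx chi z)) + dy f (chi z) * RtoC (Im (dx chi z)))%C.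
Proof.
intros [H K] Hz; apply C_ext; cbn.
- rewrite (dxR_comp Om' Om chi Ho Hchi Hmap _ z H Hz); cbn; ring.
- rewrite (dxR_comp Om' Om chi Ho Hchi Hmap _ z K Hz); cbn; ring.
Qed.

Lemma dy_comp (f : C -> C) (z : C) : isC1 Om f -> Om' z ->
  dy (fun p => f (chi p)) z
  = (dx f (chi z) * RtoC (Re (dy chi z)) + dy f (chi z) * RtoC (Im (dy chi z)))%C.
Proof.
intros [H K] Hz; apply C_ext; cbn.
- rewrite (dyR_comp Om' Om chi Ho Hchi Hmap _ z H Hz); cbn; ring.
- rewrite (dyR_comp Om' Om chi Ho Hchi Hmap _ z K Hz); cbn; ring.
Qed.

End ComplexChain.

Local Open Scope C_scope.

(** * Data representing a system, and their uniqueness up to gauge *)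

Lemma C2_neq_0 : RtoC 2 <> 0.
Proof. intros E; apply RtoC_inj in E; lra. Qed.

(** Rewriting with this lets [ring] and [field] see the complex numeral 2 as a sum of units. *)
Lemma RtoC_2 : RtoC 2 = 1 + 1.
Proof. rewrite <- RtoC_plus; f_equal; ring. Qed.

Lemma Ci2 : Ci * Ci = - RtoC 1.
Proof. apply C_ext; cbn; ring. Qed.

Lemma Ci_neq_0 : Ci <> 0.
Proof. intros E; apply (f_equal Im) in E; cbn in E; lra. Qed.

Lemma Cmult_eq_0 (a b : C) : a * b = 0 -> a <> 0 -> b = 0.
Proof.
intros E H; replace b with (/ a * (a * b)) by (field; exact H).
rewrite E; ring.
Qed.

Lemma Chalf_neq_0 (a : C) : a <> 0 -> a / 2 <> 0.
Proof.
intros H E; apply H; replace a with (2 * (a / 2)) by (field; exact C2_neq_0).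
rewrite E; ring.
Qed.

Lemma Cminus_eq_0 (a b : C) : a - b = 0 -> a = b.
Proof. intros E; replace a with (a - b + b) by ring; rewrite E; ring. Qed.

Lemma Cmod_sq (w : C) : (Cmod w ^ 2 = Re w ^ 2 + Im w ^ 2)%R.
Proof.
unfold Cmod; rewrite pow2_sqrt; [reflexivity|].
generalize (pow2_ge_0 (fst w)) (pow2_ge_0 (snd w)); lra.
Qed.

Lemma Cmod_lt_sq (a b : C) :
  (Cmod a < Cmod b)%R <-> (Re a ^ 2 + Im a ^ 2 < Re b ^ 2 + Im b ^ 2)%R.
Proof.
rewrite <- !Cmod_sq; generalize (Cmod_ge_0 a) (Cmod_ge_0 b); split; nra.
Qed.

Lemma Cmod_lt_1 (w : C) : (Cmod w < 1)%R <-> (Re w ^ 2 + Im w ^ 2 < 1)%R.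
Proof.
rewrite <- Cmod_1 at 1; rewrite Cmod_lt_sq; cbn; split; lra.
Qed.

Lemma mu_neq_1 (mu : C) : (Cmod mu < 1)%R -> 1 - mu <> 0.
Proof.
rewrite Cmod_lt_1; intros H E; assert (mu = 1) as -> by
  (symmetry; apply Cminus_eq_0, E).
cbn in H; lra.
Qed.

(** The Cayley transform maps the unit disc to the upper half-plane: the imaginary part is (1 -
    |mu|^2) / |1 - mu|^2. *)
Lemma Im_spectral_root (mu : C -> C) (z : C) :
  (Cmod (mu z) < 1)%R -> (0 < Im (spectral_root mu z))%R.
Proof.
intros H; assert (N := Csqnorm_neq_0 _ (mu_neq_1 _ H)).
rewrite Cmod_lt_1 in H; unfold spectral_root.
destruct (mu z) as [a b]; cbn in *.
assert (P : (0 < (1 + - a) ^ 2 + (0 + - b) ^ 2)%R).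
{ generalize (pow2_ge_0 (1 + - a)) (pow2_ge_0 (0 + - b)).
  intros; cbn in *; lra. }
match goal with |- (0 < ?x)%R =>
  replace x with ((1 - (a * (a * 1) + b * (b * 1)))
                    / ((1 + - a) ^ 2 + (0 + - b) ^ 2))%R end.
- apply Rdiv_lt_0_compat; lra.
- cbn; field; cbn in P; lra.
Qed.

(* rho annihilates Q - l P, so l is the root of the real quadratic det (Q - l P)
   in the upper half-plane; the kernel is a line because P and Q are real. *)
Lemma pencil_unique (P Q : mat2 R) (rho rho' om om' : C * C) (m m' l l' : C) :
  det2 P <> 0%R -> m <> 0 -> m' <> 0 ->
  om <> (RtoC 0, RtoC 0) -> om' <> (RtoC 0, RtoC 0) ->
  (0 < Im l)%R -> (0 < Im l')%R ->
  rowmul rho (toC P) = (m * fst om, m * snd om) ->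
  rowmul rho (toC Q) = (l * m * fst om, l * m * snd om) ->
  rowmul rho' (toC P) = (m' * fst om', m' * snd om') ->
  rowmul rho' (toC Q) = (l' * m' * fst om', l' * m' * snd om') ->
  l = l' /\ fst om * snd om' = snd om * fst om'.
Proof.
destruct P as [p q r s], Q as [p' q' r' s'], rho as [x y], rho' as [x' y'],
  om as [u v], om' as [u' v']; unfold rowmul, toC, det2; cbn [fst snd m11 m12 m21 m22].
intros HP Hm Hm' Hom Hom' Hl Hl' [E1 E2]%pair_equal_spec [E3 E4]%pair_equal_spec
  [F1 F2]%pair_equal_spec [F3 F4]%pair_equal_spec.
assert (K1 : x * (RtoC p' - l * RtoC p) + y * (RtoC r' - l * RtoC r) = 0).
{ transitivity ((x * RtoC p' + y * RtoC r') - l * (x * RtoC p + y * RtoC r));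
    [ring|rewrite E1, E3; ring]. }
assert (K2 : x * (RtoC q' - l * RtoC q) + y * (RtoC s' - l * RtoC s) = 0).
{ transitivity ((x * RtoC q' + y * RtoC s') - l * (x * RtoC q + y * RtoC s));
    [ring|rewrite E2, E4; ring]. }
assert (K1' : x' * (RtoC p' - l' * RtoC p) + y' * (RtoC r' - l' * RtoC r) = 0).
{ transitivity ((x' * RtoC p' + y' * RtoC r') - l' * (x' * RtoC p + y' * RtoC r));
    [ring|rewrite F1, F3; ring]. }
assert (K2' : x' * (RtoC q' - l' * RtoC q) + y' * (RtoC s' - l' * RtoC s) = 0).
{ transitivity ((x' * RtoC q' + y' * RtoC s') - l' * (x' * RtoC q + y' * RtoC s));
    [ring|rewrite F2, F4; ring]. }
(* A nonzero row in the left kernel of a 2 by 2 matrix forces its determinant to vanish. *)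
assert (D : forall x y k a b c d : C, x * a + y * c = 0 -> x * b + y * d = 0 ->
   (k * x <> 0 \/ k * y <> 0) -> a * d - b * c = 0).
{ clear; intros x y k a b c d E1 E2 [N|N].
  - apply (Cmult_eq_0 (k * x)); trivial.
    transitivity (k * ((x * a + y * c) * d - (x * b + y * d) * c));
      [ring|rewrite E1, E2; ring].
  - apply (Cmult_eq_0 (k * y)); trivial.
    transitivity (k * ((x * b + y * d) * a - (x * a + y * c) * b));
      [ring|rewrite E1, E2; ring]. }
(* The kernel row is nonzero because its image under P is the nonzero row m om. *)
assert (N : forall x y u v m : C, (u, v) <> (RtoC 0, RtoC 0) -> m <> 0 ->
   x * RtoC p + y * RtoC r = m * u -> x * RtoC q + y * RtoC s = m * v ->
   1 * x <> 0 \/ 1 * y <> 0).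
{ clear; intros x y u v m H Hm E1 E2.
  destruct (Ceq_dec (1 * x) 0) as [X|X]; [|tauto].
  destruct (Ceq_dec (1 * y) 0) as [Y|Y]; [|tauto].
  exfalso; apply H; rewrite Cmult_1_l in X, Y; subst.
  f_equal; apply (Cmult_eq_0 m); trivial; rewrite <- ?E1, <- ?E2; ring. }
assert (Q1 := D _ _ _ _ _ _ _ K1 K2 (N _ _ _ _ _ Hom Hm E1 E2)).
assert (Q2 := D _ _ _ _ _ _ _ K1' K2' (N _ _ _ _ _ Hom' Hm' F1 F2)).
assert (El : l = l').
{ apply Cminus_eq_0; destruct (Ceq_dec (l - l') 0) as [Z|Z]; trivial.
  exfalso.
  (* The difference of the two quadratics det (Q - l P) and det (Q - l' P), divided by l - l'. Since
     the coefficients are real, the imaginary part reads det P (Im l + Im l') = 0, which is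
     impossible in the upper half-plane. *)
  assert (W : RtoC (p * s - q * r) * (l + l')
              - RtoC (p * s' + p' * s - q * r' - q' * r) = 0).
  { apply (Cmult_eq_0 (l - l')); trivial.
    rewrite !RtoC_minus, RtoC_plus, !RtoC_mult.
    etransitivity; [|rewrite <- (Cplus_opp_r 0); apply f_equal2;
      [exact Q1|apply f_equal; exact Q2]]. ring. }
  apply (f_equal Im) in W; cbn in W; unfold Im in Hl, Hl'.
  apply HP; apply Rmult_eq_reg_r with (snd l + snd l')%R; lra. }
split; trivial; subst l'.
(* Two independent kernel rows would give Q = l P; with real entries and l not real this means P =
   0, against det P <> 0. *)
assert (X : x * y' - y * x' = 0).
{ destruct (Ceq_dec (x * y' - y * x') 0) as [Z|Z]; trivial; exfalso.
  assert (H : forall a c, x * a + y * c = 0 -> x' * a + y' * c = 0 ->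
                          a = 0 /\ c = 0).
  { intros a c A B; split; apply (Cmult_eq_0 (x * y' - y * x')); trivial.
    - transitivity ((x * a + y * c) * y' - (x' * a + y' * c) * y);
        [ring|rewrite A, B; ring].
    - transitivity ((x' * a + y' * c) * x - (x * a + y * c) * x');
        [ring|rewrite A, B; ring]. }
  destruct (H _ _ K1 K1') as [A1 A2], (H _ _ K2 K2') as [A3 A4].
  assert (I : forall a b : R, RtoC a - l * RtoC b = 0 -> b = 0%R).
  { clear - Hl; intros a b E; apply (f_equal Im) in E; cbn in E; unfold Im in Hl.
    apply Rmult_eq_reg_r with (snd l); lra. }
  apply HP; rewrite (I _ _ A1), (I _ _ A2); ring. }
(* The 2 by 2 determinant of the rows m om and m' om' is det P times that of rho and rho'. *)
apply Cminus_eq_0, (Cmult_eq_0 (m * m')).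
- transitivity ((m * u) * (m' * v') - (m * v) * (m' * u')); [ring|].
  rewrite <- E1, <- E2, <- F1, <- F2.
  transitivity ((x * y' - y * x') * (RtoC p * RtoC s - RtoC q * RtoC r));
    [ring|rewrite X; ring].
- apply Cmult_neq_0; trivial.
Qed.

(** Determinant of the row and its conjugate, equal to 2i Im (fst om * conj (snd om)). It is nonzero
    exactly when V |-> om V is a real-linear isomorphism of the plane onto C. *)
Definition cross (om : C * C) : C :=
  fst om * Cconj (snd om) - snd om * Cconj (fst om).

Lemma cross_neq_0 (om : C * C) : cross om <> 0 -> om <> (RtoC 0, RtoC 0).
Proof. intros H E; apply H; rewrite E; unfold cross; cbn; ring. Qed.

(** Here m and n are the coefficients of w_x and w_y in w_zbar - mu w_z. The four equations match
    the coefficients of V_x, V_y, V and the constant term when w = om V is inserted into the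
    residual of D. As [rho] is a value at one point, a multiplier of L that is merely continuous can
    be absorbed into it. *)
Definition represents_at (L : rsys) (om : C -> C * C) (D : bv) (z : C)
    (rho : C * C) : Prop :=
  let m := (1 - bmu D z) / 2 in
  let n := Ci * (1 + bmu D z) / 2 in
  let lo (c : C * C -> C) := m * dx (fun p => c (om p)) z + n * dy (fun p => c (om p)) z
              + bA D z * c (om z) + bB D z * Cconj (c (om z)) in
  rowmul rho (toC (sA1 L z)) = (m * fst (om z), m * snd (om z)) /\
  rowmul rho (toC (sA2 L z)) = (n * fst (om z), n * snd (om z)) /\
  rowmul rho (toC (sA0 L z)) = (lo fst, lo snd) /\
  rowapp rho (sk L z) = bF D z.

(* V solves L iff w = om V solves the equation of D: the complex residual of w
   is the combination, with row of coefficients rho, of the real residuals of V. *)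
Definition represents (Om : C -> Prop) (L : rsys) (om : C -> C * C) (D : bv) :=
  isC1 Om (fun z => fst (om z)) /\ isC1 Om (fun z => snd (om z)) /\
  forall z, Om z -> cross (om z) <> 0 /\ exists rho, represents_at L om D z rho.

(** With it the first two equations of [represents_at] say rho (A2 - l A1) = 0, l being the spectral
    root. *)
Lemma n_root (mu : C -> C) (z : C) : 1 - mu z <> 0 ->
  Ci * (1 + mu z) / 2 = spectral_root mu z * ((1 - mu z) / 2).
Proof.
intros H; unfold spectral_root; field; exact H.
Qed.

Lemma rowmul_inj (M : mat2 R) (r r' : C * C) : det2 M <> 0%R ->
  rowmul r (toC M) = rowmul r' (toC M) -> r = r'.
Proof.
destruct M as [p q s t], r as [x y], r' as [x' y'];
  unfold det2, rowmul, toC; cbn [fst snd m11 m12 m21 m22].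
intros H [E1 E2]%pair_equal_spec.
assert (N : RtoC p * RtoC t - RtoC q * RtoC s <> 0).
{ rewrite <- !RtoC_mult, <- RtoC_minus; intros K; apply H, RtoC_inj, K. }
f_equal; apply Cminus_eq_0, (Cmult_eq_0 (RtoC p * RtoC t - RtoC q * RtoC s)); trivial.
- transitivity ((x * RtoC p + y * RtoC s) * RtoC t - (x * RtoC q + y * RtoC t) * RtoC s
    - (x' * RtoC p + y' * RtoC s) * RtoC t + (x' * RtoC q + y' * RtoC t) * RtoC s);
    [ring|rewrite E1, E2; ring].
- transitivity ((x * RtoC q + y * RtoC t) * RtoC p - (x * RtoC p + y * RtoC s) * RtoC q
    - (x' * RtoC q + y' * RtoC t) * RtoC p + (x' * RtoC p + y' * RtoC s) * RtoC q);
    [ring|rewrite E1, E2; ring].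
Qed.

Lemma rowmul_scal (c : C) (r : C * C) (M : mat2 C) :
  rowmul (c * fst r, c * snd r) M = (c * fst (rowmul r M), c * snd (rowmul r M)).
Proof. unfold rowmul; cbn; f_equal; ring. Qed.

(** Cramer's rule for the basis formed by a row and its conjugate; this is what separates the
    coefficient of w from that of its conjugate. *)
Lemma cross_solve (om : C * C) (a b a' b' : C) : cross om <> 0 ->
  a * fst om + b * Cconj (fst om) = a' * fst om + b' * Cconj (fst om) ->
  a * snd om + b * Cconj (snd om) = a' * snd om + b' * Cconj (snd om) ->
  a = a' /\ b = b'.
Proof.
destruct om as [u v]; unfold cross; cbn [fst snd].
generalize (Cconj u) (Cconj v); intros u' v' H E1 E2.
split; apply Cminus_eq_0, (Cmult_eq_0 (u * v' - v * u')); trivial.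
- transitivity ((a * u + b * u') * v' - (a * v + b * v') * u'
    - (a' * u + b' * u') * v' + (a' * v + b' * v') * u'); [ring|].
  rewrite E1, E2; ring.
- transitivity ((a * v + b * v') * u - (a * u + b * u') * v
    - (a' * v + b' * v') * u + (a' * u + b' * u') * v); [ring|].
  rewrite E1, E2; ring.
Qed.

Lemma Cconj_neq_0 (a : C) : a <> 0 -> Cconj a <> 0.
Proof.
intros H E; apply H; rewrite <- (Cconj_conj a), E; apply C_ext; cbn; ring.
Qed.

Section Unique.
Variables (Om : C -> Prop) (L : rsys) (om om' : C -> C * C) (D D' : bv).
Hypotheses (Ho : open Om)
  (HP : forall z, Om z -> det2 (sA1 L z) <> 0%R)
  (Hmu : forall z, Om z -> (Cmod (bmu D z) < 1)%R)
  (Hmu' : forall z, Om z -> (Cmod (bmu D' z) < 1)%R)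
  (HR : represents Om L om D) (HR' : represents Om L om' D')
  (Hs : forall z, Om z -> snd (om z) <> 0).

(** The second entries are used because they never vanish in the applications: [omega0] has the
    entry lambda there, and (1, i) S has i (phi - psi), nonzero when |psi| > |phi|. *)
Let phi (z : C) : C := snd (om' z) / snd (om z).

Lemma represents_mu_om (z : C) : Om z ->
  bmu D' z = bmu D z /\ fst (om z) * snd (om' z) = snd (om z) * fst (om' z).
Proof.
intros Hz.
destruct HR as (_ & _ & R), HR' as (_ & _ & R').
destruct (R z Hz) as (X & rho & E1 & E2 & _), (R' z Hz) as (X' & rho' & E1' & E2' & _).
assert (M := mu_neq_1 _ (Hmu z Hz)); assert (M' := mu_neq_1 _ (Hmu' z Hz)).
rewrite (n_root _ z M) in E2; rewrite (n_root _ z M') in E2'.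
destruct (pencil_unique (sA1 L z) (sA2 L z) rho rho' (om z) (om' z)
  ((1 - bmu D z) / 2) ((1 - bmu D' z) / 2) (spectral_root (bmu D) z)
  (spectral_root (bmu D') z)) as [El Ex]; trivial.
- apply HP, Hz.
- apply Chalf_neq_0, M.
- apply Chalf_neq_0, M'.
- apply cross_neq_0, X.
- apply cross_neq_0, X'.
- apply Im_spectral_root, Hmu, Hz.
- apply Im_spectral_root, Hmu', Hz.
- split; trivial.
  unfold spectral_root in El; apply Cminus_eq_0.
  apply (Cmult_eq_0 ((1 + 1) * Ci)).
  (* Clearing denominators in the equality of spectral roots leaves 2i times the difference of the
     two mu. *)
  + transitivity (((1 - bmu D z) * (1 - bmu D' z)) *
     (Ci * (1 + bmu D' z) / (1 - bmu D' z) - Ci * (1 + bmu D z) / (1 - bmu D z)));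
     [field; split; trivial|rewrite El; ring].
  + apply Cmult_neq_0; [rewrite <- RtoC_2; exact C2_neq_0|exact Ci_neq_0].
Qed.

Lemma represents_ratio (z : C) : Om z ->
  fst (om' z) = phi z * fst (om z) /\ snd (om' z) = phi z * snd (om z) /\
  snd (om' z) <> 0.
Proof.
intros Hz; destruct (represents_mu_om z Hz) as [_ E].
assert (A : fst (om' z) = phi z * fst (om z)).
{ unfold phi; transitivity (fst (om z) * snd (om' z) / snd (om z));
    [rewrite E|]; field; apply Hs, Hz. }
repeat split; trivial.
- unfold phi; field; apply Hs, Hz.
- intros K; unfold phi in A; rewrite K in A.
  destruct (proj2 (proj2 HR') z Hz) as [X _]; apply cross_neq_0 in X; apply X.
  rewrite (surjective_pairing (om' z)), A, K; f_equal; field; apply Hs, Hz.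
Qed.

Lemma represents_phi_C1 : isC1 Om phi.
Proof. apply isC1_div; trivial; [apply HR'|apply HR]. Qed.

(** Insert om' = phi om into the zeroth order row of D'. The product rule yields phi times the
    derivative terms of om, which cancel against those of D, and a remainder in om and its conjugate
    alone; comparing coefficients in that basis gives the two gauge formulas. *)
Lemma represents_gauge : bv_eq Om D' (gauge phi D).
Proof.
intros z Hz; destruct (represents_mu_om z Hz) as [Emu _].
destruct (represents_ratio z Hz) as (Ef & Es & N).
assert (Np : phi z <> 0) by (intros K; apply N; rewrite Es, K; ring).
assert (Cp := represents_phi_C1).
destruct HR as (C1 & C2 & R), HR' as (C1' & C2' & R').
destruct (R z Hz) as (X & rho & E1 & E2 & E3 & E4),
  (R' z Hz) as (X' & rho' & E1' & E2' & E3' & E4').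
rewrite Emu in E1', E2', E3'.
(* The x-coefficient alone determines the combination row, since [sA1] is invertible. *)
assert (Er : rho' = (phi z * fst rho, phi z * snd rho)).
{ apply (rowmul_inj _ _ _ (HP z Hz)); rewrite E1', rowmul_scal, E1, Ef, Es; cbn.
  f_equal; ring. }
rewrite Er in E3', E4'; rewrite rowmul_scal, E3 in E3'; cbn [fst snd] in E3'.
assert (Dx : forall c : C * C -> C, isC1 Om (fun p => c (om p)) ->
   (forall p, Om p -> c (om' p) = phi p * c (om p)) ->
   dx (fun p => c (om' p)) z = dx phi z * c (om z) + phi z * dx (fun p => c (om p)) z /\
   dy (fun p => c (om' p)) z = dy phi z * c (om z) + phi z * dy (fun p => c (om p)) z).
{ intros c Hc Ec; split.
  - rewrite <- (dx_mult Om Ho phi (fun p => c (om p))); trivial.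
    apply (dx_ext Om); trivial.
  - rewrite <- (dy_mult Om Ho phi (fun p => c (om p))); trivial.
    apply (dy_ext Om); trivial. }
destruct (Dx fst C1 (fun p Hp => proj1 (represents_ratio p Hp))) as [-> ->] in E3'.
destruct (Dx snd C2 (fun p Hp => proj1 (proj2 (represents_ratio p Hp)))) as [-> ->] in E3'.
apply pair_equal_spec in E3'; destruct E3' as [F1 F2].
rewrite Ef in F1; rewrite Es in F2; rewrite Cmult_conj in F1, F2.
assert (Np' := Cconj_neq_0 _ Np).
set (m := (1 - bmu D z) / 2) in *; set (n := Ci * (1 + bmu D z) / 2) in *.
(* The first pair is phi times the zeroth order coefficients of D; the second comes from D', with
   the derivatives of phi added to the coefficient of om. *)
destruct (cross_solve (om z) (phi z * bA D z) (phi z * bB D z)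
  (m * dx phi z + n * dy phi z + bA D' z * phi z) (bB D' z * Cconj (phi z))) as [A B];
  trivial.
- match type of F1 with ?a = _ => transitivity (a - phi z *
    (m * dx (fun p => fst (om p)) z + n * dy (fun p => fst (om p)) z));
    [ring|rewrite F1; ring] end.
- match type of F2 with ?a = _ => transitivity (a - phi z *
    (m * dx (fun p => snd (om p)) z + n * dy (fun p => snd (om p)) z));
    [ring|rewrite F2; ring] end.
- assert (Em : m * dx phi z + n * dy phi z = dzbar phi z - bmu D z * dz phi z).
  { unfold m, n, dzbar, dz; field; exact C2_neq_0. }
  rewrite Em in A; unfold gauge; cbn; repeat split.
  + exact Emu.
  + transitivity (((dzbar phi z - bmu D z * dz phi z + bA D' z * phi z)
       - dzbar phi z + bmu D z * dz phi z) / phi z); [field; exact Np|].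
    rewrite <- A; field; exact Np.
  + transitivity (bB D' z * Cconj (phi z) / Cconj (phi z)); [field; exact Np'|].
    rewrite <- B; field; exact Np'.
  + rewrite <- E4', <- E4; unfold rowapp; cbn; ring.
Qed.

End Unique.

(** * The normal form represents its system *)

Lemma rowmul_mmul (r : C * C) (M N : mat2 R) :
  rowmul r (toC (mmul M N)) = rowmul (rowmul r (toC M)) (toC N).
Proof.
unfold rowmul, toC, mmul; cbn; rewrite !RtoC_plus, !RtoC_mult; f_equal; ring.
Qed.

Lemma rowapp_mapp (r : C * C) (M : mat2 R) (V : C) :
  rowapp r (mapp M V) = rowapp (rowmul r (toC M)) V.
Proof.
unfold rowapp, rowmul, toC, mapp; cbn; rewrite !RtoC_plus, !RtoC_mult; ring.
Qed.

Lemma mmul_assoc (M N P : mat2 R) : mmul M (mmul N P) = mmul (mmul M N) P.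
Proof. unfold mmul; cbn; f_equal; ring. Qed.

Lemma det2_mmul (M N : mat2 R) : det2 (mmul M N) = (det2 M * det2 N)%R.
Proof. unfold mmul, det2; cbn; ring. Qed.

Lemma det2_minv (M : mat2 R) : det2 M <> 0%R -> det2 (minv M) = (/ det2 M)%R.
Proof.
intros H; unfold minv, mscal; unfold det2 at 1; cbn.
transitivity (/ det2 M * / det2 M * det2 M)%R; [unfold det2; ring|field; exact H].
Qed.

Lemma rowmul_minv_l (r : C * C) (M : mat2 R) : det2 M <> 0%R ->
  rowmul (rowmul r (toC (minv M))) (toC M) = r.
Proof.
intros H; rewrite <- rowmul_mmul.
replace (mmul (minv M) M) with (Mat2 1 0 0 1)%R.
- destruct r; unfold rowmul; cbn; f_equal; ring.
- unfold minv, mscal, mmul, det2 in *; cbn; f_equal; field; exact H.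
Qed.

Lemma represents_at_left_mul (M : C -> mat2 R) (L : rsys) om D z rho :
  represents_at (left_mul M L) om D z rho ->
  represents_at L om D z (rowmul rho (toC (M z))).
Proof.
unfold represents_at, left_mul; cbn [sA1 sA2 sA0 sk].
rewrite !rowmul_mmul, rowapp_mapp; trivial.
Qed.

Lemma represents_left_mul (Om : C -> Prop) (M : C -> mat2 R) (L : rsys) om D :
  GL2 Om M -> represents Om L om D -> represents Om (left_mul M L) om D.
Proof.
intros HM (C1 & C2 & R); split; [exact C1|split; [exact C2|]]; intros z H.
split.
- apply R, H.
- destruct (R z H) as (_ & rho & E); exists (rowmul rho (toC (minv (M z)))).
  unfold represents_at, left_mul in *; cbn [sA1 sA2 sA0 sk].
  rewrite !rowmul_mmul, rowapp_mapp, rowmul_minv_l; trivial; apply HM, H.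
Qed.

(** * Determinant conics and what ellipticity gives *)

Lemma conic_left_mul (M : C -> mat2 R) (L : rsys) (z : C) (x y : R) :
  conic (left_mul M L) z x y = (det2 (M z) * conic L z x y)%R.
Proof.
unfold conic; rewrite <- det2_mmul; f_equal.
unfold left_mul, madd, mscal, mmul; cbn; f_equal; ring.
Qed.

Lemma conic_subst (S : C -> mat2 R) (L : rsys) (z : C) (x y : R) :
  conic (subst S L) z x y = (det2 (S z) * conic L z x y)%R.
Proof.
rewrite Rmult_comm; unfold conic; rewrite <- det2_mmul; f_equal.
unfold subst, madd, mscal, mmul; cbn; f_equal; ring.
Qed.

Lemma elliptic_det_sA1 (Om : C -> Prop) (L : rsys) (z : C) :
  elliptic Om L -> Om z -> det2 (sA1 L z) <> 0%R.
Proof.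
intros H Hz E; apply (H z Hz 1%R 0%R).
- intros K; apply pair_equal_spec in K; lra.
- etransitivity; [|exact E]; unfold conic, madd, mscal, det2; cbn; ring.
Qed.

(** Were the second columns of A1 and A2 dependent, some nontrivial x A1 + y A2 would have a zero
    second column and hence zero determinant. So an elliptic system can always be normalised to
    second columns (0, 1) and (-1, 0). *)
Lemma elliptic_skel_den (Om : C -> Prop) (L : rsys) (z : C) :
  elliptic Om L -> Om z -> det2 (skel_den L z) <> 0%R.
Proof.
intros H Hz E; unfold det2, skel_den in E; cbn in E.
assert (K : forall x y : R, (x <> 0 \/ y <> 0)%R ->
   (x * m12 (sA1 L z) + y * m12 (sA2 L z) = 0)%R ->
   (x * m22 (sA1 L z) + y * m22 (sA2 L z) = 0)%R -> False).
{ intros x y N E1 E2; apply (H z Hz x y).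
  - intros [-> ->]%pair_equal_spec; destruct N; auto.
  - unfold conic, madd, mscal, det2; cbn; rewrite E1, E2; ring. }
(* A nonzero entry of the second column of [sA1] supplies the nontrivial pair (x, y); if that column
   vanishes, (1, 0) does. *)
destruct (Req_dec (m12 (sA1 L z)) 0) as [K1|K1];
  destruct (Req_dec (m22 (sA1 L z)) 0) as [K2|K2].
- apply (K 1%R 0%R); [left|rewrite K1|rewrite K2]; lra.
- rewrite K1 in E.
  apply (K (- m22 (sA2 L z))%R (m22 (sA1 L z))); [auto| |ring].
  rewrite K1; lra.
- apply (K (- m12 (sA2 L z))%R (m12 (sA1 L z))); [auto|ring|lra].
- apply (K (- m12 (sA2 L z))%R (m12 (sA1 L z))); [auto|ring|lra].
Qed.

(** Otherwise the quadratic formula, cleared of its denominator 2a, gives the zero (-b + sqrt (b^2 -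
    4ac), 2a). Negative definite forms are covered as well as positive ones. *)
Lemma definite_form (a b c : R) :
  (forall x y : R, (x, y) <> (0, 0)%R -> a * x ^ 2 + b * x * y + c * y ^ 2 <> 0)%R ->
  (a <> 0 /\ b ^ 2 < 4 * a * c)%R.
Proof.
intros H.
assert (Ha : a <> 0%R).
{ intros E; apply (H 1%R 0%R); [intros K%pair_equal_spec; lra|rewrite E; ring]. }
split; trivial; apply Rnot_le_lt; intros K.
apply (H (- b + sqrt (b ^ 2 - 4 * a * c))%R (2 * a)%R).
- intros [_ J]%pair_equal_spec; lra.
- assert (S : (sqrt (b ^ 2 - 4 * a * c) * sqrt (b ^ 2 - 4 * a * c)
               = b ^ 2 - 4 * a * c)%R) by (apply sqrt_sqrt; lra).
  transitivity (a * (sqrt (b ^ 2 - 4 * a * c) * sqrt (b ^ 2 - 4 * a * c)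
     - (b ^ 2 - 4 * a * c)))%R; [ring|rewrite S; ring].
Qed.

Lemma Cconj_RtoC (a : R) : Cconj (RtoC a) = RtoC a.
Proof. apply C_ext; cbn; ring. Qed.

Section Pipeline.
Variables (Om : C -> Prop) (L : rsys).
Hypotheses (Ho : open Om) (HE : elliptic Om L) (HS : has_skeleton_form Om L).

Let s : skeleton := skeleton_of L.

Lemma skel_A1 (z : C) : Om z -> sA1 (skel_sys L) z = Mat2 (a11 s z) 0%R (a21 s z) 1%R.
Proof.
intros Hz; destruct (skel_sysP (proj1 HS z Hz)) as (E1 & E2 & _).
unfold s; cbn [a11 a21 skeleton_of]; rewrite <- E1, <- E2.
destruct (sA1 (skel_sys L) z); reflexivity.
Qed.

Lemma skel_A2 (z : C) : Om z -> sA2 (skel_sys L) z = Mat2 (a12 s z) (-1)%R (a22 s z) 0%R.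
Proof.
intros Hz; destruct (skel_sysP (proj1 HS z Hz)) as (_ & _ & E1 & E2).
unfold s; cbn [a12 a22 skeleton_of]; rewrite <- E1, <- E2.
destruct (sA2 (skel_sys L) z); reflexivity.
Qed.

Lemma skel_A0 (z : C) : sA0 (skel_sys L) z = Mat2 (a13 s z) (a14 s z) (a23 s z) (a24 s z).
Proof.
unfold s; cbn [a13 a14 a23 a24 skeleton_of].
destruct (sA0 (skel_sys L) z); reflexivity.
Qed.

Lemma skel_k (z : C) : sk (skel_sys L) z = (f1 s z, f2 s z).
Proof. unfold s; cbn [f1 f2 skeleton_of]; apply surjective_pairing. Qed.

Lemma conic_skel (z : C) (x y : R) : Om z ->
  conic (skel_sys L) z x y
  = (a11 s z * x ^ 2 + (a12 s z + a21 s z) * x * y + a22 s z * y ^ 2)%R.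
Proof.
intros Hz; unfold conic; rewrite skel_A1, skel_A2 by trivial.
unfold madd, mscal, det2; cbn; ring.
Qed.

Lemma skel_definite (z : C) : Om z ->
  (a11 s z <> 0 /\ (a12 s z + a21 s z) ^ 2 < 4 * a11 s z * a22 s z)%R.
Proof.
intros Hz; apply definite_form; intros x y N.
rewrite <- conic_skel by trivial; unfold skel_sys; rewrite conic_left_mul.
apply Rmult_integral_contrapositive_currified; [|apply HE; trivial].
assert (K := proj1 HS z Hz); rewrite det2_minv; trivial.
apply Rinv_neq_0_compat, K.
Qed.

Lemma skel_a22 (z : C) : Om z -> a22 s z <> 0%R.
Proof.
intros Hz E; destruct (skel_definite z Hz) as [_ D]; rewrite E in D.
generalize (pow2_ge_0 (a12 s z + a21 s z)); lra.
Qed.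

(** The discriminant inequality of the skeleton conic is divided by a11^2, which is positive for
    either sign of [a11]. *)
Lemma structure_disc (z : C) : Om z -> (0 < 4 * alpha s z - beta s z ^ 2)%R.
Proof.
intros Hz; destruct (skel_definite z Hz) as [A D].
replace (4 * alpha s z - beta s z ^ 2)%R with
  ((4 * a11 s z * a22 s z - (a12 s z + a21 s z) ^ 2) / a11 s z ^ 2)%R
  by (unfold alpha, beta; field; exact A).
apply Rdiv_lt_0_compat; [lra|]; apply pow2_gt_0, A.
Qed.

Lemma elliptic_extended : extended_class Om L.
Proof.
split; trivial; intros z Hz; split; [apply skel_definite|apply structure_disc]; trivial.
Qed.

Lemma Re_lam (z : C) : Re (lam s z) = (- beta s z / 2)%R.
Proof. unfold lam; cbn; field. Qed.

Lemma Im_lam (z : C) : Im (lam s z) = (sqrt (4 * alpha s z - beta s z ^ 2) / 2)%R.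
Proof. unfold lam; cbn; field. Qed.

Lemma Im_lam_pos (z : C) : Om z -> (0 < Im (lam s z))%R.
Proof.
intros Hz; rewrite Im_lam; generalize (sqrt_lt_R0 _ (structure_disc z Hz)); lra.
Qed.

(** The polynomial is det (A2 - l A1) of the skeleton system divided by [a11], and [lam] is its root
    given by the quadratic formula. *)
Lemma lam_root (z : C) : Om z ->
  lam s z * lam s z + RtoC (beta s z) * lam s z + RtoC (alpha s z) = 0.
Proof.
intros Hz; assert (R := Re_lam z); assert (I := Im_lam z).
assert (S := sqrt_sqrt _ (Rlt_le _ _ (structure_disc z Hz))).
revert R I; generalize (lam s z); intros [p q]; cbn; intros -> ->.
apply C_ext; cbn; [|field].
set (t := sqrt _) in *.
transitivity ((4 * alpha s z - beta s z ^ 2 - t * t) / 4)%R; [field|].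
rewrite S; field.
Qed.

Lemma lam_neq_0 (z : C) : Om z -> lam s z <> 0.
Proof.
intros Hz E; generalize (Im_lam_pos z Hz); rewrite E; cbn; lra.
Qed.

Lemma lam_Ci (z : C) : Om z -> lam s z + Ci <> 0.
Proof.
intros Hz; generalize (Im_lam_pos z Hz); destruct (lam s z); cbn.
intros P E; apply (f_equal Im) in E; cbn in E; lra.
Qed.

Lemma lam_conj (z : C) : Om z -> lam s z - Cconj (lam s z) <> 0.
Proof.
intros Hz; generalize (Im_lam_pos z Hz); destruct (lam s z); cbn.
intros P E; apply (f_equal Im) in E; cbn in E; lra.
Qed.

Lemma alpha_C1 : isC1R Om (alpha s).
Proof.
apply isC1R_div; trivial; try apply HS; intros z Hz; apply skel_definite, Hz.
Qed.

Lemma beta_C1 : isC1R Om (beta s).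
Proof.
apply isC1R_div; trivial; try apply HS; [|intros z Hz; apply skel_definite, Hz].
apply isC1R_opp; trivial; apply isC1R_plus; trivial; apply HS.
Qed.

Lemma lam_C1 : isC1 Om (lam s).
Proof.
apply isC1_mult; trivial; [apply (isC1_const Om (/ 2))|].
apply isC1_plus; trivial.
- apply isC1_opp; trivial; apply isC1_RtoC, beta_C1.
- apply isC1_mult; trivial; [apply isC1_const|].
  apply isC1_RtoC, isC1R_sqrt; trivial; [|apply structure_disc].
  apply isC1R_minus; trivial.
  + apply isC1R_mult; trivial; [apply isC1R_const|apply alpha_C1].
  + apply isC1R_mult; trivial; [|apply isC1R_mult; trivial]; try apply beta_C1.
    apply isC1R_const.
Qed.

Lemma pmu_C1 : isC1 Om (pmu s).
Proof.
apply isC1_div; trivial; [| |apply lam_Ci].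
- apply isC1_minus; trivial; [apply lam_C1|apply isC1_const].
- apply isC1_plus; trivial; [apply lam_C1|apply isC1_const].
Qed.

(** A point of the upper half-plane is closer to i than to -i. *)
Lemma pmu_lt_1 (z : C) : Om z -> (Cmod (pmu s z) < 1)%R.
Proof.
intros Hz; assert (N := lam_Ci z Hz); assert (P := Im_lam_pos z Hz).
unfold pmu; rewrite Cmod_div by exact N.
apply Rmult_lt_reg_r with (Cmod (lam s z + Ci)); [apply Cmod_gt_0, N|].
unfold Rdiv; rewrite Rmult_assoc, Rinv_l, Rmult_1_r, Rmult_1_l.
- apply Cmod_lt_sq; clear N; destruct (lam s z); cbn in *; nra.
- apply Rgt_not_eq, Cmod_gt_0, N.
Qed.

Lemma pmu_root (z : C) : Om z -> spectral_root (pmu s) z = lam s z.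
Proof.
intros Hz; assert (N := lam_Ci z Hz); unfold spectral_root, pmu.
assert (E1 : 1 - (lam s z - Ci) / (lam s z + Ci) = 2 * Ci / (lam s z + Ci))
  by (rewrite RtoC_2; field; exact N).
assert (E2 : 1 + (lam s z - Ci) / (lam s z + Ci) = 2 * lam s z / (lam s z + Ci))
  by (rewrite RtoC_2; field; exact N).
rewrite E1, E2; field; split; [exact N|exact Ci_neq_0].
Qed.

Lemma omega0_C1 : isC1 Om (fun z => fst (omega0 s (lam s) z)) /\
                  isC1 Om (fun z => snd (omega0 s (lam s) z)).
Proof.
split; [|exact lam_C1].
apply isC1_minus; [exact Ho|apply isC1_RtoC, HS|].
apply isC1_mult; [exact Ho|exact lam_C1|apply isC1_RtoC, HS].
Qed.

(** The terms in [a12] cancel and the value is - a22 (lambda - conj lambda); [a22] cannot vanish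
    because the skeleton conic is definite. *)
Lemma omega0_cross (z : C) : Om z -> cross (omega0 s (lam s) z) <> 0.
Proof.
intros Hz E; apply (lam_conj z Hz), (Cmult_eq_0 (- RtoC (a22 s z))).
- rewrite <- E; unfold cross, omega0; cbn [fst snd].
  rewrite Cminus_conj, Cmult_conj, !Cconj_RtoC; ring.
- rewrite <- RtoC_opp; intros K%RtoC_inj; apply (skel_a22 z Hz); lra.
Qed.

(** The row operations of the pipeline in one: alpha times the first equation, plus lambda times
    (the second plus beta times the first). The factor (1 - mu)/2 joins the 1/2 in the definition of
    A_lambda, B_lambda, F_lambda to the final factor 1 - mu. *)
Definition skel_row (z : C) : C * C :=
  ((1 - pmu s z) / 2 * (RtoC (alpha s z) + lam s z * RtoC (beta s z)),
   (1 - pmu s z) / 2 * lam s z).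

Lemma pipeline_skel_row (z : C) : Om z ->
  represents_at (skel_sys L) (omega0 s (lam s)) (pipeline L) z (skel_row z).
Proof.
intros Hz; unfold represents_at; cbn [bmu bA bB bF pipeline]; fold s.
rewrite (n_root _ z (mu_neq_1 _ (pmu_lt_1 z Hz))), pmu_root by exact Hz.
rewrite skel_A1, skel_A2, skel_A0, skel_k by exact Hz.
unfold rowmul, rowapp, toC, skel_row, omega0; cbn [fst snd m11 m12 m21 m22 Re Im].
assert (Da : 1 - pmu s z = (1 + 1) * ((1 - pmu s z) / 2))
  by (rewrite <- RtoC_2; field; exact C2_neq_0).
set (m := (1 - pmu s z) / 2) in *.
destruct (skel_definite z Hz) as [N11 _]; assert (N22 := skel_a22 z Hz).
assert (Er := lam_root z Hz).
assert (Ea : RtoC (alpha s z) * RtoC (a11 s z) = RtoC (a22 s z))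
  by (rewrite <- RtoC_mult; f_equal; unfold alpha; field; exact N11).
assert (Eb : RtoC (beta s z) * RtoC (a11 s z) = - (RtoC (a12 s z) + RtoC (a21 s z)))
  by (rewrite <- RtoC_mult, <- RtoC_plus, <- RtoC_opp; f_equal; unfold beta;
      field; exact N11).
(* The root equation eliminates alpha; what remains are polynomial identities in lambda and beta. *)
assert (El : RtoC (alpha s z) = - (lam s z * lam s z) - RtoC (beta s z) * lam s z).
{ apply Cminus_eq_0; rewrite <- Er; ring. }
split; [|split; [|split]].
- f_equal; [|ring].
  transitivity (m * ((RtoC (alpha s z) * RtoC (a11 s z))
     + lam s z * (RtoC (beta s z) * RtoC (a11 s z)) + lam s z * RtoC (a21 s z)));
    [ring|rewrite Ea, Eb; ring].
- replace (RtoC (-1)) with (- RtoC 1) by (rewrite <- RtoC_opp; f_equal; ring).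
  rewrite El; f_equal; [|ring].
  transitivity (m * lam s z *
    (RtoC (a22 s z) - lam s z * RtoC (a12 s z))); [|ring]; ring.
- assert (HI := Rgt_not_eq _ _ (Im_lam_pos z Hz)).
  assert (HG := proj2 (G12P (s := s) (z := z) (G1 s z) (G2 s z) HI) (conj eq_refl eq_refl)).
  assert (HAB := proj2 (ABlamP (s := s) (z := z) (Alam s z) (Blam s z) HI)
                   (conj eq_refl eq_refl)).
  assert (D : forall U V : R,
    (1 + 1) * (Alam s z * (RtoC U + lam s z * RtoC V)
      + Blam s z * (RtoC U + Cconj (lam s z) * RtoC V))
    = RtoC (pa s z) * RtoC U + RtoC (pbt s z) * RtoC V
       + lam s z * (RtoC (pc s z) * RtoC U + RtoC (pdt s z) * RtoC V)).
  { intros U V; rewrite HAB, <- RtoC_2, !RtoC_plus, !RtoC_mult.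
    field; exact C2_neq_0. }
  (* (a22, - a12) and (0, 1) are the values of (U, V) at (u, v) = (1, 0) and (0, 1), so these
     instances are the two columns of the zeroth order row. *)
  assert (D1 := D (a22 s z) (- a12 s z)%R); assert (D2 := D 0%R 1%R); clear D HAB.
  assert (Dx : dx (fun p => RtoC (a22 s p) - lam s p * RtoC (a12 s p)) z
     = RtoC (dxR (a22 s) z) - (dx (lam s) z * RtoC (a12 s z)
                               + lam s z * RtoC (dxR (a12 s) z))).
  { rewrite (dx_minus Om (fun p => RtoC (a22 s p)) (fun p => lam s p * RtoC (a12 s p)));
      [|apply isC1_RtoC, HS
       |apply isC1_mult; [exact Ho|exact lam_C1|apply isC1_RtoC, HS]|exact Hz].
    rewrite (dx_mult Om Ho (lam s) (fun p => RtoC (a12 s p)));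
      [|exact lam_C1|apply isC1_RtoC, HS|exact Hz].
    rewrite !dx_RtoC; reflexivity. }
  assert (Dy : dy (fun p => RtoC (a22 s p) - lam s p * RtoC (a12 s p)) z
     = RtoC (dyR (a22 s) z) - (dy (lam s) z * RtoC (a12 s z)
                               + lam s z * RtoC (dyR (a12 s) z))).
  { rewrite (dy_minus Om (fun p => RtoC (a22 s p)) (fun p => lam s p * RtoC (a12 s p)));
      [|apply isC1_RtoC, HS
       |apply isC1_mult; [exact Ho|exact lam_C1|apply isC1_RtoC, HS]|exact Hz].
    rewrite (dy_mult Om Ho (lam s) (fun p => RtoC (a12 s p)));
      [|exact lam_C1|apply isC1_RtoC, HS|exact Hz].
    rewrite !dy_RtoC; reflexivity. }
  rewrite Dx, Dy; clear Dx Dy.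
  (* Differentiating [omega0] produces lambda_x + lambda lambda_y; replacing it by G1 + G2 lambda
     accounts for the corrections in [pbt] and [pdt]. *)
  assert (Ed : dx (lam s) z = RtoC (G1 s z) + RtoC (G2 s z) * lam s z
                              - lam s z * dy (lam s) z).
  { rewrite <- HG; unfold lam_drift; ring. }
  assert (Ec : Cconj (RtoC (a22 s z) - lam s z * RtoC (a12 s z))
               = RtoC (a22 s z) + Cconj (lam s z) * RtoC (- a12 s z)).
  { apply C_ext; unfold Cconj, RtoC; cbn; ring. }
  assert (Pa : RtoC (pa s z) * RtoC (a22 s z) = - RtoC (dxR (a22 s) z)
     - RtoC (alpha s z) * RtoC (dyR (a12 s) z) + RtoC (alpha s z) * RtoC (a13 s z)
     + RtoC (alpha s z) * RtoC (a14 s z) * RtoC (a12 s z)).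
  { rewrite <- !RtoC_opp, <- !RtoC_mult, <- RtoC_minus, <- !RtoC_plus; f_equal.
    unfold pa; field; exact N22. }
  assert (Pc : RtoC (pc s z) * RtoC (a22 s z) = RtoC (dxR (a12 s) z)
     - RtoC (dyR (a22 s) z) - RtoC (beta s z) * RtoC (dyR (a12 s) z) + RtoC (a23 s z)
     + RtoC (beta s z) * RtoC (a13 s z)
     + RtoC (a12 s z) * (RtoC (a24 s z) + RtoC (beta s z) * RtoC (a14 s z))).
  { rewrite <- !RtoC_mult, <- !RtoC_minus, <- !RtoC_plus, <- RtoC_mult, <- !RtoC_plus.
    f_equal; unfold pc; field; exact N22. }
  rewrite Pa, Pc in D1; clear Pa Pc.
  change (fun p => lam s p) with (lam s).
  rewrite Ec, Ed, Da; clear HG Ec Ed.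
  unfold pbt, pdt, pb, pd in D1, D2.
  rewrite !RtoC_minus, !RtoC_plus, !RtoC_mult, RtoC_opp in D1.
  rewrite !RtoC_minus, !RtoC_plus, !RtoC_mult in D2.
  rewrite El in D1, D2 |- *; rewrite RtoC_opp.
  f_equal; apply Cminus_eq_0.
  (* Each component of the claim is m times the corresponding instance of the relation defining
     A_lambda and B_lambda. *)
  + match type of D1 with ?a = ?b => transitivity (m * (b - a)); [ring|rewrite D1; ring] end.
  + match type of D2 with ?a = ?b => transitivity (m * (b - a)); [ring|rewrite D2; ring] end.
- rewrite Da; unfold Flam, pf, pg; rewrite <- RtoC_2, !RtoC_plus, !RtoC_mult.
  field; exact C2_neq_0.
Qed.

Lemma pipeline_represents : represents Om L (omega0 s (lam s)) (pipeline L).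
Proof.
split; [apply omega0_C1|split; [apply omega0_C1|]]; intros z Hz.
split; [apply omega0_cross, Hz|].
exists (rowmul (skel_row z) (toC (minv (skel_den L z)))).
apply (represents_at_left_mul (fun z => minv (skel_den L z)) L), pipeline_skel_row, Hz.
Qed.

End Pipeline.

(** * Regularity of the normal form and of substituted systems *)

Section PipelineBV.
Variables (Om : C -> Prop) (L : rsys).
Hypotheses (Ho : open Om) (HE : elliptic Om L) (HS : has_skeleton_form Om L).

Let s : skeleton := skeleton_of L.

(** The formulas differentiate only [a12], [a22] and lambda, each once and each C^1. The divisors
    [a11], [a22], Im lambda, lambda - conj lambda and lambda + i have no zeros, by definiteness of
    the conic and Im lambda > 0. *)
Lemma pipeline_BV : BV Om (pipeline L).
Proof.
assert (Cl := lam_C1 Om L Ho HE HS); fold s in Cl.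
assert (C1 : isC1R Om (a12 s)) by apply HS.
assert (C2 : isC1R Om (a22 s)) by apply HS.
assert (K1 := C1R_C0R _ _ Ho C1); assert (K2 := C1R_C0R _ _ Ho C2).
assert (K3 : isC0R Om (a13 s)) by apply HS.
assert (K4 : isC0R Om (a14 s)) by apply HS.
assert (K5 : isC0R Om (a23 s)) by apply HS.
assert (K6 : isC0R Om (a24 s)) by apply HS.
assert (K7 : isC0R Om (f1 s)) by apply HS.
assert (K8 : isC0R Om (f2 s)) by apply HS.
assert (Ka := C1R_C0R _ _ Ho (alpha_C1 Om L Ho HE HS)).
assert (Kb := C1R_C0R _ _ Ho (beta_C1 Om L Ho HE HS)).
fold s in Ka, Kb.
assert (N := skel_a22 Om L HE HS); fold s in N.
assert (Kl := isC1_C0 _ Ho _ Cl).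
assert (Km := isC1_C0 _ Ho _ (pmu_C1 Om L Ho HE HS)); fold s in Km.
assert (Kd : isC0 Om (lam_drift s)).
{ apply isC0_plus; [apply isC1_dxC0, Cl|].
  apply isC0_mult; [exact Kl|apply isC1_dyC0, Cl]. }
apply isC0_C0R in Kd; assert (Kl' := Kl); apply isC0_C0R in Kl'.
assert (G2C : isC0R Om (G2 s)).
{ apply isC0R_div; [apply Kd|apply Kl'|].
  intros z Hz; apply Rgt_not_eq, (Im_lam_pos Om L HE HS z Hz). }
assert (G1C : isC0R Om (G1 s)).
{ apply isC0R_minus; [apply Kd|apply isC0R_mult; [exact G2C|apply Kl']]. }
assert (Pb : isC0R Om (pbt s)).
{ apply isC0R_minus; [apply isC0R_mult|]; trivial. }
assert (Pd : isC0R Om (pdt s)).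
{ apply isC0R_minus; [apply isC0R_plus; [|apply isC0R_mult]|]; trivial. }
assert (Pa : isC0R Om (pa s)).
{ apply isC0R_div; trivial.
  apply isC0R_plus; [apply isC0R_plus; [apply isC0R_minus|]|].
  - apply isC0R_opp, isC1R_dxC0, C2.
  - apply isC0R_mult; [exact Ka|apply isC1R_dyC0, C1].
  - apply isC0R_mult; trivial.
  - apply isC0R_mult; [apply isC0R_mult|]; trivial. }
assert (Pc : isC0R Om (pc s)).
{ apply isC0R_div; trivial.
  apply isC0R_plus; [apply isC0R_plus; [apply isC0R_plus|]|].
  - apply isC0R_minus; [apply isC0R_minus|apply isC0R_mult; [exact Kb|]].
    + apply isC1R_dxC0, C1.
    + apply isC1R_dyC0, C2.
    + apply isC1R_dyC0, C1.
  - trivial.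
  - apply isC0R_mult; trivial.
  - apply isC0R_mult; [|apply isC0R_plus; [|apply isC0R_mult]]; trivial. }
assert (Nl : forall z, Om z -> RtoC 2 * (lam s z - Cconj (lam s z)) <> 0).
{ intros z Hz; apply Cmult_neq_0;
    [exact C2_neq_0|exact (lam_conj Om L HE HS z Hz)]. }
assert (Kden : isC0 Om (fun z => RtoC 2 * (lam s z - Cconj (lam s z)))).
{ apply isC0_mult; [apply isC0_const|].
  apply isC0_minus; [exact Kl|apply isC0_conj, Kl]. }
assert (K1m : isC0 Om (fun z => 1 - pmu s z))
  by (apply isC0_minus; [apply isC0_const|exact Km]).
assert (Q1 : isC0 Om (fun z => RtoC (pa s z) + lam s z * RtoC (pc s z))).
{ apply isC0_plus; [|apply isC0_mult]; trivial; apply isC0_RtoC; trivial. }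
assert (Q2 : isC0 Om (fun z => RtoC (pbt s z) + lam s z * RtoC (pdt s z))).
{ apply isC0_plus; [|apply isC0_mult]; trivial; apply isC0_RtoC; trivial. }
split; [exact (pmu_C1 Om L Ho HE HS)|].
split; [exact (pmu_lt_1 Om L HE HS)|].
split; [|split]; apply isC0_mult; trivial.
- apply isC0_div; trivial; apply isC0_minus; trivial.
  apply isC0_mult; [apply isC0_conj|]; trivial.
- apply isC0_div; trivial; apply isC0_minus; trivial; apply isC0_mult; trivial.
- apply isC0_mult; [apply (isC0_const Om (/ 2))|].
  apply isC0_plus; [|apply isC0_mult; trivial]; apply isC0_RtoC.
  + apply isC0R_mult; trivial.
  + apply isC0R_plus; [|apply isC0R_mult]; trivial.
Qed.

End PipelineBV.

(** * Skeleton forms under left multiplication *)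

Definition sys_eq_at (z : C) (L L' : rsys) : Prop :=
  sA1 L z = sA1 L' z /\ sA2 L z = sA2 L' z /\ sA0 L z = sA0 L' z /\ sk L z = sk L' z.

Lemma skel_sys_ext (z : C) (L L' : rsys) :
  sys_eq_at z L L' -> sys_eq_at z (skel_sys L) (skel_sys L').
Proof.
intros (E1 & E2 & E3 & E4); unfold sys_eq_at, skel_sys, left_mul, skel_den.
cbn [sA1 sA2 sA0 sk]; rewrite E1, E2, E3, E4; auto.
Qed.

Lemma minv_mmul (M N : mat2 R) : det2 M <> 0%R -> det2 N <> 0%R ->
  mmul (minv (mmul M N)) M = minv N.
Proof.
destruct M as [a b c d], N as [a' b' c' d'].
unfold minv, mmul, mscal, det2; cbn; intros H K; f_equal; field; split; trivial;
  intros E; apply (Rmult_integral_contrapositive_currified _ _ H K);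
  rewrite <- E; ring.
Qed.

Lemma mapp_mmul (M N : mat2 R) (V : C) : mapp (mmul M N) V = mapp M (mapp N V).
Proof. unfold mapp, mmul; cbn; f_equal; ring. Qed.

Lemma skel_den_left_mul (M : C -> mat2 R) (L : rsys) (z : C) :
  skel_den (left_mul M L) z = mmul (M z) (skel_den L z).
Proof. unfold skel_den, left_mul, mmul; cbn; f_equal; ring. Qed.

(** (M K)^(-1) M = K^(-1): normalisation cancels the multiplier, so the skeleton coefficients, and
    with them their regularity, carry over unchanged. *)
Lemma skel_sys_left_mul (M : C -> mat2 R) (L : rsys) (z : C) :
  det2 (M z) <> 0%R -> det2 (skel_den L z) <> 0%R ->
  sys_eq_at z (skel_sys (left_mul M L)) (skel_sys L).
Proof.
intros H K; unfold sys_eq_at, skel_sys; cbn [left_mul sA1 sA2 sA0 sk].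
rewrite skel_den_left_mul, !mmul_assoc, <- mapp_mmul, minv_mmul; auto.
Qed.

Lemma regular_skeleton_ext (Om : C -> Prop) (L L' : rsys) :
  open Om -> (forall z, Om z -> sys_eq_at z (skel_sys L) (skel_sys L')) ->
  regular_skeleton Om (skeleton_of L) -> regular_skeleton Om (skeleton_of L').
Proof.
intros Ho E (R1 & R2 & R3 & R4 & R5 & R6 & R7 & R8 & R9 & R10).
repeat apply conj.
1: eapply isC1R_ext; [exact Ho| |exact R1].
2: eapply isC1R_ext; [exact Ho| |exact R2].
3: eapply isC1R_ext; [exact Ho| |exact R3].
4: eapply isC1R_ext; [exact Ho| |exact R4].
5: eapply isC0R_ext; [exact Ho| |exact R5].
6: eapply isC0R_ext; [exact Ho| |exact R6].
7: eapply isC0R_ext; [exact Ho| |exact R7].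
8: eapply isC0R_ext; [exact Ho| |exact R8].
9: eapply isC0R_ext; [exact Ho| |exact R9].
10: eapply isC0R_ext; [exact Ho| |exact R10].
all: intros z Hz; destruct (E z Hz) as (E1 & E2 & E3 & E4);
  cbn [skeleton_of a11 a12 a13 a14 a21 a22 a23 a24 f1 f2];
  rewrite ?E1, ?E2, ?E3, ?E4; reflexivity.
Qed.

Lemma has_skeleton_form_left_mul (Om : C -> Prop) (M : C -> mat2 R) (L : rsys) :
  open Om -> GL2 Om M -> has_skeleton_form Om L -> has_skeleton_form Om (left_mul M L).
Proof.
intros Ho HM [Hd HR]; split.
- intros z Hz; rewrite skel_den_left_mul, det2_mmul.
  apply Rmult_integral_contrapositive_currified; auto.
- revert HR; apply regular_skeleton_ext; trivial; intros z Hz.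
  destruct (skel_sys_left_mul M L z (HM z Hz) (Hd z Hz)) as (E1 & E2 & E3 & E4).
  repeat split; auto.
Qed.

(** * Skeleton forms under substitution *)

Lemma entrywise_mono (P Q : (C -> R) -> Prop) (M : C -> mat2 R) :
  (forall f, P f -> Q f) -> entrywise P M -> entrywise Q M.
Proof. intros H (H1 & H2 & H3 & H4); split; auto; split; auto. Qed.

Section Entrywise.
Variable Om : C -> Prop.
Hypothesis Ho : open Om.

Lemma entrywise_C1_C0 (M : C -> mat2 R) :
  entrywise (isC1R Om) M -> entrywise (isC0R Om) M.
Proof. apply entrywise_mono; intros f; apply C1R_C0R, Ho. Qed.

Lemma mmul_C1 (M N : C -> mat2 R) :
  entrywise (isC1R Om) M -> entrywise (isC1R Om) N ->
  entrywise (isC1R Om) (fun z => mmul (M z) (N z)).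
Proof.
intros (M1 & M2 & M3 & M4) (N1 & N2 & N3 & N4).
repeat apply conj; apply (isC1R_plus Om Ho); apply (isC1R_mult Om Ho); trivial.
Qed.

Lemma mmul_C0 (M N : C -> mat2 R) :
  entrywise (isC0R Om) M -> entrywise (isC0R Om) N ->
  entrywise (isC0R Om) (fun z => mmul (M z) (N z)).
Proof.
intros (M1 & M2 & M3 & M4) (N1 & N2 & N3 & N4).
repeat apply conj; apply isC0R_plus; apply isC0R_mult; trivial.
Qed.

Lemma madd_C0 (M N : C -> mat2 R) :
  entrywise (isC0R Om) M -> entrywise (isC0R Om) N ->
  entrywise (isC0R Om) (fun z => madd (M z) (N z)).
Proof.
intros (M1 & M2 & M3 & M4) (N1 & N2 & N3 & N4).
repeat apply conj; apply isC0R_plus; trivial.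
Qed.

Lemma minv_C1 (M : C -> mat2 R) :
  entrywise (isC1R Om) M -> GL2 Om M -> entrywise (isC1R Om) (fun z => minv (M z)).
Proof.
intros (M1 & M2 & M3 & M4) H.
assert (D : isC1R Om (fun z => / det2 (M z))%R).
{ apply isC1R_inv; trivial; apply isC1R_minus; trivial; apply isC1R_mult; trivial. }
repeat apply conj; apply (isC1R_mult Om Ho); trivial; apply isC1R_opp; trivial.
Qed.

Lemma dxM_C0 (M : C -> mat2 R) :
  entrywise (isC1R Om) M -> entrywise (isC0R Om) (dxM M).
Proof.
intros (M1 & M2 & M3 & M4); repeat apply conj; apply isC1R_dxC0; trivial.
Qed.

Lemma dyM_C0 (M : C -> mat2 R) :
  entrywise (isC1R Om) M -> entrywise (isC0R Om) (dyM M).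
Proof.
intros (M1 & M2 & M3 & M4); repeat apply conj; apply isC1R_dyC0; trivial.
Qed.

Lemma has_skeleton_form_C1 (L : rsys) :
  elliptic Om L -> entrywise (isC1R Om) (sA1 L) -> entrywise (isC1R Om) (sA2 L) ->
  entrywise (isC0R Om) (sA0 L) -> isC0 Om (sk L) -> has_skeleton_form Om L.
Proof.
intros HE H1 H2 H3 H4.
assert (Hd : forall z, Om z -> det2 (skel_den L z) <> 0%R)
  by (intros z; apply elliptic_skel_den, HE).
split; trivial.
assert (Hi : entrywise (isC1R Om) (fun z => minv (skel_den L z))).
{ apply minv_C1; trivial; destruct H1 as (? & B1 & ? & D1), H2 as (? & B2 & ? & D2).
  split; [exact (isC1R_opp Om Ho _ B2)|split; [exact B1|]].
  split; [exact (isC1R_opp Om Ho _ D2)|exact D1]. }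
destruct (mmul_C1 _ _ Hi H1) as (P1 & P2 & P3 & P4).
destruct (mmul_C1 _ _ Hi H2) as (Q1 & Q2 & Q3 & Q4).
destruct (mmul_C0 _ _ (entrywise_C1_C0 _ Hi) H3) as (R1 & R2 & R3 & R4).
apply isC0_C0R in H4; destruct H4 as [K1 K2].
destruct (entrywise_C1_C0 _ Hi) as (I1 & I2 & I3 & I4).
refine (conj P1 (conj Q1 (conj P3 (conj Q3 (conj R1 (conj R2 (conj R3 (conj R4
  (conj _ _))))))))).
- apply (isC0R_plus _ _ _ (isC0R_mult _ _ _ I1 K1) (isC0R_mult _ _ _ I2 K2)).
- apply (isC0R_plus _ _ _ (isC0R_mult _ _ _ I3 K1) (isC0R_mult _ _ _ I4 K2)).
Qed.

Lemma has_skeleton_form_subst_C1 (S : C -> mat2 R) (L : rsys) :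
  entrywise (isC1R Om) S -> elliptic Om (subst S L) ->
  entrywise (isC1R Om) (sA1 L) -> entrywise (isC1R Om) (sA2 L) ->
  entrywise (isC0R Om) (sA0 L) -> isC0 Om (sk L) -> has_skeleton_form Om (subst S L).
Proof.
intros HS HE H1 H2 H3 H4; apply has_skeleton_form_C1.
- exact HE.
- exact (mmul_C1 _ _ H1 HS).
- exact (mmul_C1 _ _ H2 HS).
- apply madd_C0; [exact (mmul_C0 _ _ H3 (entrywise_C1_C0 _ HS))|apply madd_C0].
  + exact (mmul_C0 _ _ (entrywise_C1_C0 _ H1) (dxM_C0 _ HS)).
  + exact (mmul_C0 _ _ (entrywise_C1_C0 _ H2) (dyM_C0 _ HS)).
- exact H4.
Qed.

Lemma skel_sys_C1 (L : rsys) : elliptic Om L -> has_skeleton_form Om L ->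
  entrywise (isC1R Om) (sA1 (skel_sys L)) /\ entrywise (isC1R Om) (sA2 (skel_sys L)) /\
  entrywise (isC0R Om) (sA0 (skel_sys L)) /\ isC0 Om (sk (skel_sys L)).
Proof.
intros HE HS; assert (R := proj2 HS).
destruct R as (R1 & R2 & R3 & R4 & R5 & R6 & R7 & R8 & R9 & R10).
assert (E1 := fun z Hz => skel_A1 Om L HS z Hz).
assert (E2 := fun z Hz => skel_A2 Om L HS z Hz).
split; [|split; [|split]]; [split; [|split; [|split]]|split; [|split; [|split]]| |].
- exact R1.
- apply (isC1R_ext Om (fun _ => 0%R)); [exact Ho| |apply isC1R_const].
  intros z Hz; rewrite E1; trivial.
- exact R3.
- apply (isC1R_ext Om (fun _ => 1%R)); [exact Ho| |apply isC1R_const].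
  intros z Hz; rewrite E1; trivial.
- exact R2.
- apply (isC1R_ext Om (fun _ => (-1)%R)); [exact Ho| |apply isC1R_const].
  intros z Hz; rewrite E2; trivial.
- exact R4.
- apply (isC1R_ext Om (fun _ => 0%R)); [exact Ho| |apply isC1R_const].
  intros z Hz; rewrite E2; trivial.
- split; [exact R5|split; [exact R6|split; [exact R7|exact R8]]].
- apply isC0_C0R; split; [exact R9|exact R10].
Qed.

Lemma elliptic_left_mul (M : C -> mat2 R) (L : rsys) :
  GL2 Om M -> elliptic Om L -> elliptic Om (left_mul M L).
Proof.
intros HM HE z Hz x y N; rewrite conic_left_mul.
apply Rmult_integral_contrapositive_currified; [apply HM|apply HE]; trivial.
Qed.

Lemma elliptic_subst (S : C -> mat2 R) (L : rsys) :
  GL2 Om S -> elliptic Om L -> elliptic Om (subst S L).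
Proof.
intros HM HE z Hz x y N; rewrite conic_subst.
apply Rmult_integral_contrapositive_currified; [apply HM|apply HE]; trivial.
Qed.

Lemma GL2_skel (L : rsys) : elliptic Om L -> GL2 Om (fun z => minv (skel_den L z)).
Proof.
intros HE z Hz; assert (H := elliptic_skel_den Om L z HE Hz).
rewrite det2_minv by exact H; apply Rinv_neq_0_compat, H.
Qed.

(** The hypothesis controls the skeleton of L, not the coefficients of L, so the regularity argument
    is run on [subst S (skel_sys L)]. That system is a left multiple of [subst S L], hence has the
    same skeleton. *)
Lemma has_skeleton_form_subst (S : C -> mat2 R) (L : rsys) :
  entrywise (isC1R Om) S -> GL2 Om S -> elliptic Om L -> has_skeleton_form Om L ->
  has_skeleton_form Om (subst S L).
Proof.
intros HS HG HE HL.
assert (HE' := elliptic_subst S L HG HE).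
assert (Hd : forall z, Om z -> det2 (skel_den (subst S L) z) <> 0%R)
  by (intros z; apply elliptic_skel_den, HE').
split; trivial.
destruct (skel_sys_C1 L HE HL) as (H1 & H2 & H3 & H4).
assert (K : has_skeleton_form Om (subst S (skel_sys L))).
{ apply has_skeleton_form_subst_C1; trivial; apply elliptic_subst; trivial.
  apply elliptic_left_mul; trivial; apply GL2_skel, HE. }
apply (regular_skeleton_ext Om (subst S (skel_sys L))); [exact Ho| |exact (proj2 K)].
intros z Hz.
(* Left multiplication acts on equations and substitution on unknowns, so the two commute. *)
assert (E : sys_eq_at z (subst S (skel_sys L))
              (left_mul (fun z => minv (skel_den L z)) (subst S L))).
{ unfold sys_eq_at, subst, skel_sys, left_mul, mmul, madd; cbn.
  repeat split; f_equal; ring. }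
destruct (skel_sys_ext _ _ _ E) as (E1 & E2 & E3 & E4).
destruct (skel_sys_left_mul (fun z => minv (skel_den L z)) (subst S L) z
  (GL2_skel L HE z Hz) (Hd z Hz)) as (F1 & F2 & F3 & F4).
repeat split; etransitivity; eassumption.
Qed.

End Entrywise.

(** om (S V') and (om S) V' are the same complex function, so D and [rho] are kept. Nondegeneracy
    survives because [cross] is multiplied by det S, of either sign. *)
Lemma represents_subst (Om : C -> Prop) (S : C -> mat2 R) (L : rsys) om D :
  open Om -> entrywise (isC1R Om) S -> GL2 Om S -> represents Om L om D ->
  represents Om (subst S L) (fun z => rowmul (om z) (toC (S z))) D.
Proof.
intros Ho (S1 & S2 & S3 & S4) HG (C1 & C2 & HR).
apply isC1_RtoC in S1, S2, S3, S4.
assert (M : forall f g : C -> C, isC1 Om f -> isC1 Om g ->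
  isC1 Om (fun z => fst (om z) * f z + snd (om z) * g z)).
{ intros f g Hf Hg; apply isC1_plus; trivial; apply isC1_mult; trivial. }
split; [apply M; trivial|split; [apply M; trivial|]]; intros z Hz.
destruct (HR z Hz) as (X & rho & E1 & E2 & E3 & E4); split.
- assert (N : RtoC (det2 (S z)) <> 0) by (intros K%RtoC_inj; apply (HG z Hz K)).
  intros K; apply X, (Cmult_eq_0 (RtoC (det2 (S z)))); trivial.
  rewrite <- K; unfold cross, rowmul, toC, det2; cbn [fst snd m11 m12 m21 m22].
  rewrite !Cplus_conj, !Cmult_conj, !Cconj_RtoC, RtoC_minus, !RtoC_mult; ring.
- exists rho; unfold represents_at; cbn [subst sA1 sA2 sA0 sk].
  set (m := (1 - bmu D z) / 2) in *; set (n := Ci * (1 + bmu D z) / 2) in *.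
  assert (Dx : forall f g : C -> C, isC1 Om f -> isC1 Om g ->
    dx (fun p => fst (om p) * f p + snd (om p) * g p) z
    = (dx (fun p => fst (om p)) z * f z + fst (om z) * dx f z)
      + (dx (fun p => snd (om p)) z * g z + snd (om z) * dx g z)).
  { intros f g Hf Hg; rewrite (dx_plus Om); trivial; try (apply isC1_mult; trivial).
    rewrite (dx_mult Om Ho (fun p => fst (om p)) f); trivial.
    rewrite (dx_mult Om Ho (fun p => snd (om p)) g); trivial. }
  assert (Dy : forall f g : C -> C, isC1 Om f -> isC1 Om g ->
    dy (fun p => fst (om p) * f p + snd (om p) * g p) z
    = (dy (fun p => fst (om p)) z * f z + fst (om z) * dy f z)
      + (dy (fun p => snd (om p)) z * g z + snd (om z) * dy g z)).
  { intros f g Hf Hg; rewrite (dy_plus Om); trivial; try (apply isC1_mult; trivial).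
    rewrite (dy_mult Om Ho (fun p => fst (om p)) f); trivial.
    rewrite (dy_mult Om Ho (fun p => snd (om p)) g); trivial. }
  split; [|split; [|split]].
  + rewrite rowmul_mmul, E1; unfold rowmul; cbn; f_equal; ring.
  + rewrite rowmul_mmul, E2; unfold rowmul; cbn; f_equal; ring.
  + assert (A : forall M N : mat2 R, rowmul rho (toC (madd M N))
      = (fst (rowmul rho (toC M)) + fst (rowmul rho (toC N)),
         snd (rowmul rho (toC M)) + snd (rowmul rho (toC N)))).
    { intros; unfold rowmul, toC, madd; cbn [fst snd m11 m12 m21 m22].
      rewrite !RtoC_plus; f_equal; ring. }
    rewrite !A, !rowmul_mmul, E1, E2, E3.
    unfold rowmul, toC, dxM, dyM; cbn [fst snd m11 m12 m21 m22].
    rewrite !Dx, !Dy by trivial.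
    rewrite !dx_RtoC, !dy_RtoC, !Cplus_conj, !Cmult_conj, !Cconj_RtoC.
    f_equal; ring.
  + exact E4.
Qed.

(** * Realification, solutions and eigenpairing *)

(** The two columns are the values of zeta |-> a zeta + b conj zeta at 1 and i. The second one is
    the origin of the denominator phi - psi. *)
Lemma rowmul_rlin (a b : C) : rowmul (RtoC 1, Ci) (toC (rlin a b)) = (a + b, Ci * (a - b)).
Proof.
destruct a, b; unfold rowmul, toC, rlin; cbn [fst snd m11 m12 m21 m22]; f_equal;
  apply C_ext; cbn; ring.
Qed.

Lemma dx_const (c : C) (z : C) : dx (fun _ => c) z = 0.
Proof. apply C_ext; [apply (Derive_const (Re c))|apply (Derive_const (Im c))]. Qed.

Lemma dy_const (c : C) (z : C) : dy (fun _ => c) z = 0.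
Proof. apply C_ext; [apply (Derive_const (Re c))|apply (Derive_const (Im c))]. Qed.

Lemma represents_realification (Om : C -> Prop) (D : bv) :
  represents Om (realification D) (fun _ => (RtoC 1, Ci)) D.
Proof.
split; [apply isC1_const|split; [apply isC1_const|]]; intros z _; split.
- intros E; apply (f_equal Im) in E; cbn in E; lra.
- exists (RtoC 1, Ci); unfold represents_at; cbn [realification sA1 sA2 sA0 sk fst snd].
  rewrite !rowmul_rlin, !dx_const, !dy_const, Cconj_RtoC.
  replace (Cconj Ci) with (- Ci) by (apply C_ext; cbn; ring).
  split; [|split; [|split]]; try (f_equal; ring).
  unfold rowapp; destruct (bF D z); apply C_ext; cbn; ring.
Qed.

(** The principal symbol is multiplication by a complex number, whose real determinant is its
    squared modulus. *)
Lemma conic_realification (D : bv) (z : C) (x y : R) :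
  conic (realification D) z x y
  = (Cmod (RtoC x * ((1 - bmu D z) / 2) + RtoC y * (Ci * (1 + bmu D z) / 2)) ^ 2)%R.
Proof.
rewrite Cmod_sq; unfold conic, realification; cbn [sA1 sA2].
generalize ((1 - bmu D z) / 2) (Ci * (1 + bmu D z) / 2); intros [a b] [c d].
unfold madd, mscal, rlin, det2; cbn; ring.
Qed.

Lemma elliptic_realification (Om : C -> Prop) (D : bv) :
  (forall z, Om z -> (Cmod (bmu D z) < 1)%R) -> elliptic Om (realification D).
Proof.
intros H z Hz x y N; rewrite conic_realification.
assert (M := mu_neq_1 _ (H z Hz)); assert (I := Im_spectral_root _ _ (H z Hz)).
apply pow_nonzero, Rgt_not_eq, Cmod_gt_0; rewrite (n_root _ _ M); intros E.
(* A zero of the symbol would be a real linear relation between 1 and the non-real spectral root. *)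
assert (E' : RtoC x + RtoC y * spectral_root (bmu D) z = 0).
{ apply (Cmult_eq_0 ((1 - bmu D z) / 2)); [|apply Chalf_neq_0, M].
  rewrite <- E; ring. }
revert I E'; generalize (spectral_root (bmu D) z); intros [p q] I E'; cbn in I.
apply N; assert (E1 := f_equal Re E'); assert (E2 := f_equal Im E'); cbn in E1, E2.
assert (y = 0)%R as -> by (apply Rmult_eq_reg_r with q; lra).
f_equal; lra.
Qed.

Lemma rlin_C1 (Om : C -> Prop) (f g : C -> C) :
  open Om -> isC1 Om f -> isC1 Om g -> entrywise (isC1R Om) (fun z => rlin (f z) (g z)).
Proof.
intros Ho [F1 F2] [K1 K2]; split; [|split; [|split]].
- apply (isC1R_plus Om Ho _ _ F1 K1).
- apply (isC1R_minus Om Ho _ _ K2 F2).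
- apply (isC1R_plus Om Ho _ _ F2 K2).
- apply (isC1R_minus Om Ho _ _ F1 K1).
Qed.

Lemma rlin_C0 (Om : C -> Prop) (f g : C -> C) :
  isC0 Om f -> isC0 Om g -> entrywise (isC0R Om) (fun z => rlin (f z) (g z)).
Proof.
rewrite !isC0_C0R; intros [F1 F2] [K1 K2]; split; [|split; [|split]].
- apply (isC0R_plus Om _ _ F1 K1).
- apply (isC0R_minus Om _ _ K2 F2).
- apply (isC0R_plus Om _ _ F2 K2).
- apply (isC0R_minus Om _ _ F1 K1).
Qed.

Lemma has_skeleton_form_realification_subst (Om : C -> Prop) (S : C -> mat2 R) (D : bv) :
  open Om -> BV Om D -> entrywise (isC1R Om) S -> GL2 Om S ->
  has_skeleton_form Om (subst S (realification D)).
Proof.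
intros Ho (B1 & B2 & B3 & B4 & B5) HS HG; apply has_skeleton_form_subst_C1.
- exact Ho.
- exact HS.
- apply elliptic_subst; [exact HG|apply elliptic_realification, B2].
- apply rlin_C1; [exact Ho| |apply isC1_const].
  apply isC1_mult; [exact Ho| |apply (isC1_const Om (/ 2))].
  apply isC1_minus; [exact Ho|apply isC1_const|exact B1].
- apply rlin_C1; [exact Ho| |apply isC1_const].
  apply isC1_mult; [exact Ho| |apply (isC1_const Om (/ 2))].
  apply isC1_mult; [exact Ho|apply isC1_const|].
  apply isC1_plus; [exact Ho|apply isC1_const|exact B1].
- exact (rlin_C0 Om _ _ B3 B4).
- exact B5.
Qed.

(** * Residuals and solutions of represented systems *)

Lemma represents_at_Res (Om : C -> Prop) (L : rsys) om D z rho (V : C -> C) :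
  open Om -> isC1 Om (fun p => fst (om p)) -> isC1 Om (fun p => snd (om p)) ->
  represents_at L om D z rho -> isC1 Om V -> Om z ->
  Res D (fun p => rowapp (om p) (V p)) z = rowapp rho (sys_res L V z).
Proof.
intros Ho C1 C2 (E1 & E2 & E3 & E4) [V1 V2] Hz.
assert (Ru := isC1_RtoC _ _ V1); assert (Rv := isC1_RtoC _ _ V2).
assert (A : rowapp rho (sys_res L V z) =
  rowapp (rowmul rho (toC (sA1 L z))) (dx V z) + rowapp (rowmul rho (toC (sA2 L z))) (dy V z)
  + rowapp (rowmul rho (toC (sA0 L z))) (V z) - rowapp rho (sk L z)).
{ rewrite <- !rowapp_mapp; unfold sys_res, rowapp.
  generalize (mapp (sA1 L z) (dx V z)) (mapp (sA2 L z) (dy V z))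
    (mapp (sA0 L z) (V z)) (sk L z); intros [a a'] [b b'] [c c'] [d d'].
  cbn [Re Im Cplus Cminus Copp fst snd]; rewrite !RtoC_plus, !RtoC_opp; ring. }
rewrite A, E1, E2, E3, E4; unfold Res, dzbar, dz.
assert (Dx : dx (fun p => rowapp (om p) (V p)) z
  = (dx (fun p => fst (om p)) z * RtoC (Re (V z)) + fst (om z) * RtoC (Re (dx V z)))
    + (dx (fun p => snd (om p)) z * RtoC (Im (V z)) + snd (om z) * RtoC (Im (dx V z)))).
{ unfold rowapp; rewrite (dx_plus Om); [|apply isC1_mult; trivial|apply isC1_mult; trivial|trivial].
  rewrite (dx_mult Om Ho (fun p => fst (om p)) (fun p => RtoC (Re (V p)))) by trivial.
  rewrite (dx_mult Om Ho (fun p => snd (om p)) (fun p => RtoC (Im (V p)))) by trivial.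
  rewrite !dx_RtoC; reflexivity. }
assert (Dy : dy (fun p => rowapp (om p) (V p)) z
  = (dy (fun p => fst (om p)) z * RtoC (Re (V z)) + fst (om z) * RtoC (Re (dy V z)))
    + (dy (fun p => snd (om p)) z * RtoC (Im (V z)) + snd (om z) * RtoC (Im (dy V z)))).
{ unfold rowapp; rewrite (dy_plus Om); [|apply isC1_mult; trivial|apply isC1_mult; trivial|trivial].
  rewrite (dy_mult Om Ho (fun p => fst (om p)) (fun p => RtoC (Re (V p)))) by trivial.
  rewrite (dy_mult Om Ho (fun p => snd (om p)) (fun p => RtoC (Im (V p)))) by trivial.
  rewrite !dy_RtoC; reflexivity. }
rewrite Dx, Dy; unfold rowapp; cbn [fst snd].
rewrite Cplus_conj, !Cmult_conj, !Cconj_RtoC; field; exact C2_neq_0.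
Qed.

(** From rho A1 = m om one gets det A1 cross(rho) = |m|^2 cross(om). The complex residual therefore
    loses no real information, as the converse direction for solutions requires. *)
Lemma represents_row_cross (L : rsys) om D z rho :
  (Cmod (bmu D z) < 1)%R -> cross (om z) <> 0 -> represents_at L om D z rho ->
  cross rho <> 0.
Proof.
intros Hm X (E & _) K; apply X.
assert (M := Chalf_neq_0 _ (mu_neq_1 _ Hm)).
set (m := (1 - bmu D z) / 2) in *.
apply (Cmult_eq_0 (m * Cconj m)); [|apply Cmult_neq_0; [|apply Cconj_neq_0]; exact M].
assert (F : cross (rowmul rho (toC (sA1 L z))) = m * Cconj m * cross (om z)).
{ rewrite E; unfold cross; cbn [fst snd]; rewrite !Cmult_conj; ring. }
rewrite <- F; transitivity (RtoC (det2 (sA1 L z)) * cross rho).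
- unfold cross, rowmul, toC, det2; cbn [fst snd m11 m12 m21 m22].
  rewrite !Cplus_conj, !Cmult_conj, !Cconj_RtoC, RtoC_minus, !RtoC_mult; ring.
- rewrite K; ring.
Qed.

(** The equation and its conjugate form a linear system in Re V and Im V with determinant
    [cross rho]. *)
Lemma rowapp_eq_0 (rho : C * C) (V : C) : cross rho <> 0 -> rowapp rho V = 0 -> V = 0.
Proof.
intros X E.
assert (E' := f_equal Cconj E); unfold rowapp in E, E'.
rewrite Cplus_conj, !Cmult_conj, !Cconj_RtoC in E'.
assert (A : RtoC (Re V) = 0).
{ apply (Cmult_eq_0 (cross rho)); trivial; unfold cross.
  match type of E with ?a = _ => match type of E' with ?b = _ =>
    transitivity (a * Cconj (snd rho) - b * snd rho); [ring|rewrite E, E'; ring]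
  end end. }
assert (B : RtoC (Im V) = 0).
{ apply (Cmult_eq_0 (cross rho)); trivial; unfold cross.
  match type of E with ?a = _ => match type of E' with ?b = _ =>
    transitivity (b * fst rho - a * Cconj (fst rho)); [ring|rewrite E, E'; ring]
  end end. }
apply RtoC_inj in A, B; apply C_ext; trivial.
Qed.

Lemma represents_solutions (Om : C -> Prop) (L : rsys) om D (V : C -> C) :
  open Om -> (forall z, Om z -> (Cmod (bmu D z) < 1)%R) -> represents Om L om D ->
  isC1 Om V ->
  (forall z, Om z -> sys_res L V z = 0) <->
  (forall z, Om z -> Res D (fun p => rowapp (om p) (V p)) z = 0).
Proof.
intros Ho Hm (C1 & C2 & HR) HV; split; intros H z Hz; destruct (HR z Hz) as (X & rho & E).
- rewrite (represents_at_Res Om L om D z rho V), H; trivial.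
  unfold rowapp; cbn; ring.
- apply (rowapp_eq_0 rho).
  + apply (represents_row_cross L om D z); auto.
  + rewrite <- (represents_at_Res Om L om D z rho V); auto.
Qed.

Lemma represents_ext (Om : C -> Prop) (L : rsys) (om om' : C -> C * C) D :
  open Om -> (forall z, Om z -> om z = om' z) ->
  represents Om L om D -> represents Om L om' D.
Proof.
intros Ho E (C1 & C2 & HR).
assert (E1 : forall z, Om z -> fst (om z) = fst (om' z)) by (intros; rewrite E; trivial).
assert (E2 : forall z, Om z -> snd (om z) = snd (om' z)) by (intros; rewrite E; trivial).
split; [exact (isC1_ext Om _ _ Ho E1 C1)|].
split; [exact (isC1_ext Om _ _ Ho E2 C2)|].
intros z Hz; destruct (HR z Hz) as (X & rho & F).
rewrite <- E by trivial; split; trivial; exists rho; unfold represents_at in *.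
rewrite <- E by trivial.
rewrite <- (dx_ext Om _ _ z Ho E1 Hz), <- (dx_ext Om _ _ z Ho E2 Hz),
  <- (dy_ext Om _ _ z Ho E1 Hz), <- (dy_ext Om _ _ z Ho E2 Hz); exact F.
Qed.

(** * Representing data as eigenpairings *)

Lemma rowmul_minv_r (r : C * C) (M : mat2 R) : det2 M <> 0%R ->
  rowmul (rowmul r (toC M)) (toC (minv M)) = r.
Proof.
intros H; rewrite <- rowmul_mmul.
replace (mmul M (minv M)) with (Mat2 1 0 0 1)%R.
- destruct r; unfold rowmul; cbn; f_equal; ring.
- unfold minv, mscal, mmul, det2 in *; cbn; f_equal; field; exact H.
Qed.

Lemma rowmul_Xi (om : C -> C * C) (a b : C) (z : C) : cross (om z) <> 0 ->
  rowmul (a * fst (om z) + b * Cconj (fst (om z)),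
          a * snd (om z) + b * Cconj (snd (om z))) (Cminv (Xi om z)) = (a, b).
Proof.
unfold cross, rowmul, Cminv, Xi, Cdet2; cbn [fst snd m11 m12 m21 m22]; intros H.
f_equal; field; exact H.
Qed.

Section Eigen.
Variables (Om : C -> Prop) (L : rsys) (om : C -> C * C) (l : C -> C) (D : bv).
Hypotheses (HP : forall z, Om z -> det2 (sA1 L z) <> 0%R)
  (Hm : forall z, Om z -> (Cmod (bmu D z) < 1)%R)
  (Hl : forall z, Om z -> l z = spectral_root (bmu D) z)
  (HR : represents Om L om D).

(** Inverting rho A1 = m om gives om A1^(-1) = rho / m, and 1 / m = 2 / (1 - mu) = 1 - i l: this is
    the normalising denominator of the eigenpairing. *)
Lemma represents_om_inv (z : C) (rho : C * C) : Om z -> represents_at L om D z rho ->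
  rowmul (om z) (toC (minv (sA1 L z)))
  = ((1 - Ci * l z) * fst rho, (1 - Ci * l z) * snd rho) /\
  (1 - bmu D z) / 2 * (1 - Ci * l z) = 1 /\
  (l z - Ci) / (l z + Ci) = bmu D z.
Proof.
intros Hz (E & _); assert (M := mu_neq_1 _ (Hm z Hz)).
assert (G : (1 - bmu D z) / 2 * (1 - Ci * l z) = 1).
{ rewrite Hl by trivial; unfold spectral_root.
  transitivity ((1 - bmu D z) / 2 * (1 - (Ci * Ci) * ((1 + bmu D z) / (1 - bmu D z))));
    [field; exact M|rewrite Ci2, RtoC_2; field; exact M]. }
split; [|split; [exact G|]].
- rewrite <- (rowmul_minv_r rho (sA1 L z)) by (apply HP, Hz).
  rewrite E, rowmul_scal; cbn [fst snd].
  set (c := 1 - Ci * l z) in *; set (m := (1 - bmu D z) / 2) in *.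
  rewrite (surjective_pairing (rowmul (om z) _)); cbn [fst snd].
  f_equal.
  + transitivity (m * c * fst (rowmul (om z) (toC (minv (sA1 L z)))));
      [rewrite G; ring|ring].
  + transitivity (m * c * snd (rowmul (om z) (toC (minv (sA1 L z)))));
      [rewrite G; ring|ring].
- rewrite Hl by trivial; unfold spectral_root.
  replace (Ci * (1 + bmu D z) / (1 - bmu D z) - Ci)
    with (2 * Ci * bmu D z / (1 - bmu D z)) by (rewrite RtoC_2; field; exact M).
  replace (Ci * (1 + bmu D z) / (1 - bmu D z) + Ci)
    with (2 * Ci / (1 - bmu D z)) by (rewrite RtoC_2; field; exact M).
  field; split; [exact M|exact Ci_neq_0].
Qed.

Lemma represents_eigenrow : eigenrow Om L l om.
Proof.
destruct HR as (C1 & C2 & HR'); split; [exact C1|split; [exact C2|]].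
intros z Hz; destruct (HR' z Hz) as (X & rho & E).
split; [apply cross_neq_0, X|].
split; [rewrite Hl by trivial; apply Im_spectral_root, Hm, Hz|].
destruct (represents_om_inv z rho Hz E) as (F & G & _); destruct E as (_ & E & _).
unfold sysN; rewrite rowmul_mmul, F, rowmul_scal, E; cbn [fst snd].
rewrite (n_root _ _ (mu_neq_1 _ (Hm z Hz))), <- Hl by trivial.
f_equal.
- transitivity (l z * ((1 - bmu D z) / 2 * (1 - Ci * l z)) * fst (om z));
    [ring|rewrite G; ring].
- transitivity (l z * ((1 - bmu D z) / 2 * (1 - Ci * l z)) * snd (om z));
    [ring|rewrite G; ring].
Qed.

(** Write c = 1 - i l. Then om P = c rho A0 = om_x + l om_y + c (A om + B conj om), so the row being
    paired is - c (A om + B conj om), and multiplication by the inverse of [Xi] reads off its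
    coordinates. *)
Lemma represents_eigenpairing : bv_eq Om D (eigenpairing L l om).
Proof.
intros z Hz; destruct (proj2 (proj2 HR) z Hz) as (X & rho & E).
destruct (represents_om_inv z rho Hz E) as (F & G & K).
destruct E as (_ & _ & E3 & E4).
rewrite (n_root _ _ (mu_neq_1 _ (Hm z Hz))), <- Hl in E3 by trivial.
unfold eigenpairing; cbn [bmu bA bB bF]; unfold sysP, sysh.
rewrite rowapp_mapp, rowmul_mmul, F, rowmul_scal, E3; cbn [fst snd].
assert (N : 1 - Ci * l z <> 0).
{ intros K0; rewrite K0 in G.
  rewrite Cmult_0_r in G; apply RtoC_inj in G; lra. }
set (m := (1 - bmu D z) / 2) in *; set (c := 1 - Ci * l z) in *.
match goal with |- context [rowmul (?x, ?y) _] =>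
  replace x with (- (c * bA D z) * fst (om z) + - (c * bB D z) * Cconj (fst (om z)));
  [replace y with (- (c * bA D z) * snd (om z) + - (c * bB D z) * Cconj (snd (om z)))|]
end.
- rewrite rowmul_Xi by exact X; cbn [fst snd].
  split; [symmetry; exact K|]; split; [field; exact N|split; [field; exact N|]].
  rewrite <- E4; unfold rowapp; cbn [fst snd]; field; exact N.
- apply Cminus_eq_0.
  transitivity ((m * c - 1) * (dx (fun p => snd (om p)) z + l z * dy (fun p => snd (om p)) z));
    [ring|rewrite G; ring].
- apply Cminus_eq_0.
  transitivity ((m * c - 1) * (dx (fun p => fst (om p)) z + l z * dy (fun p => fst (om p)) z));
    [ring|rewrite G; ring].
Qed.

End Eigen.

(** * Coordinate changes and invariant assignments *)

Definition pull_den (chi mu : C -> C) (z : C) : C :=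
  dz chi z + mu (chi z) * Cconj (dzbar chi z).
Definition pull_num (chi mu : C -> C) (z : C) : C :=
  dzbar chi z + mu (chi z) * Cconj (dz chi z).

(** This identity carries all pointwise conditions on a pullback: J > 0 and |mu| < 1 make the
    denominator nonzero and the quotient smaller than 1 in modulus. *)
Lemma pull_den_num (chi mu : C -> C) (z : C) :
  (Cmod (pull_den chi mu z) ^ 2 - Cmod (pull_num chi mu z) ^ 2
   = jac chi z * (1 - Cmod (mu (chi z)) ^ 2))%R.
Proof.
unfold jac, pull_den, pull_num; rewrite !Cmod_sq.
destruct (dz chi z), (dzbar chi z), (mu (chi z)); cbn; ring.
Qed.

Lemma pull_lt (chi mu : C -> C) (z : C) :
  (0 < jac chi z)%R -> (Cmod (mu (chi z)) < 1)%R ->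
  (Cmod (pull_num chi mu z) < Cmod (pull_den chi mu z))%R.
Proof.
intros HJ Hm; assert (E := pull_den_num chi mu z).
apply Cmod_lt_1 in Hm; rewrite <- Cmod_sq in Hm.
assert (0 < jac chi z * (1 - Cmod (mu (chi z)) ^ 2))%R
  by (apply Rmult_lt_0_compat; lra).
apply Cmod_lt_sq; rewrite <- !Cmod_sq; lra.
Qed.

Lemma pull_den_neq_0 (chi mu : C -> C) (z : C) :
  (0 < jac chi z)%R -> (Cmod (mu (chi z)) < 1)%R -> pull_den chi mu z <> 0.
Proof.
intros HJ Hm E; generalize (pull_lt chi mu z HJ Hm); rewrite E, Cmod_0.
generalize (Cmod_ge_0 (pull_num chi mu z)); lra.
Qed.

Lemma pullback_mu_lt_1 (chi : C -> C) (D : bv) (z : C) :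
  (0 < jac chi z)%R -> (Cmod (bmu D (chi z)) < 1)%R ->
  (Cmod (bmu (pullback chi D) z) < 1)%R.
Proof.
intros HJ Hm; assert (N := pull_den_neq_0 _ _ _ HJ Hm).
cbn [pullback bmu]; fold (pull_num chi (bmu D) z); fold (pull_den chi (bmu D) z).
rewrite Cmod_div by exact N.
apply Rmult_lt_reg_r with (Cmod (pull_den chi (bmu D) z)); [apply Cmod_gt_0, N|].
unfold Rdiv; rewrite Rmult_assoc, Rinv_l, Rmult_1_r, Rmult_1_l.
- apply pull_lt; trivial.
- apply Rgt_not_eq, Cmod_gt_0, N.
Qed.

Lemma jac_det (chi : C -> C) (z : C) :
  jac chi z = det2 (Mat2 (Re (dx chi z)) (Re (dy chi z)) (Im (dx chi z)) (Im (dy chi z))).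
Proof.
unfold jac, dz, dzbar, det2; rewrite !Cmod_sq.
destruct (dx chi z), (dy chi z); cbn; field.
Qed.

Lemma rowmul_lin (r : C * C) (x y : R) (M N : mat2 R) :
  rowmul r (toC (madd (mscal x M) (mscal y N)))
  = (RtoC x * fst (rowmul r (toC M)) + RtoC y * fst (rowmul r (toC N)),
     RtoC x * snd (rowmul r (toC M)) + RtoC y * snd (rowmul r (toC N))).
Proof.
unfold rowmul, toC, madd, mscal; cbn [fst snd m11 m12 m21 m22].
rewrite !RtoC_plus, !RtoC_mult; f_equal; ring.
Qed.

(** The row is composed with chi, and [rho] is rescaled by kappa, the factor that restores the form
    w_zbar - mu w_z after the change of variables. *)
Lemma represents_pullback (Om' Om : C -> Prop) (chi : C -> C) (L : rsys) om D :
  open Om' -> open Om -> isC1 Om' chi -> (forall z, Om' z -> (0 < jac chi z)%R) ->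
  (forall z, Om' z -> Om (chi z)) -> (forall z, Om z -> (Cmod (bmu D z) < 1)%R) ->
  represents Om L om D ->
  represents Om' (coord_change chi L) (fun z => om (chi z)) (pullback chi D).
Proof.
intros Ho' Ho Hchi HJ Hmap Hm (C1 & C2 & HR).
split; [exact (isC1_comp Om' Om chi Ho' Ho Hchi Hmap _ C1)|].
split; [exact (isC1_comp Om' Om chi Ho' Ho Hchi Hmap _ C2)|].
intros z Hz; destruct (HR (chi z) (Hmap z Hz)) as (X & rho & E1 & E2 & E3 & E4).
split; [exact X|].
assert (N := pull_den_neq_0 chi (bmu D) z (HJ z Hz) (Hm _ (Hmap z Hz))).
assert (NJ : RtoC (jac chi z) <> 0)
  by (intros K%RtoC_inj; generalize (HJ z Hz); lra).
set (den := pull_den chi (bmu D) z) in *.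
exists (RtoC (jac chi z) / den * fst rho, RtoC (jac chi z) / den * snd rho).
unfold represents_at.
rewrite (dx_comp Om' Om chi Ho Hchi Hmap (fun w => fst (om w)) z C1 Hz),
  (dx_comp Om' Om chi Ho Hchi Hmap (fun w => snd (om w)) z C2 Hz),
  (dy_comp Om' Om chi Ho Hchi Hmap (fun w => fst (om w)) z C1 Hz),
  (dy_comp Om' Om chi Ho Hchi Hmap (fun w => snd (om w)) z C2 Hz).
cbn [coord_change pullback sA1 sA2 sA0 sk bmu bA bB bF].
fold (pull_num chi (bmu D) z); fold (pull_den chi (bmu D) z); fold den.
rewrite !rowmul_scal, !rowmul_lin, E1, E2, E3; cbn [fst snd].
unfold minv, mscal; rewrite <- jac_det; cbn [m11 m12 m21 m22].
rewrite !RtoC_mult, !RtoC_inv, !RtoC_opp by (generalize (HJ z Hz); lra).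
set (m := (1 - bmu D (chi z)) / 2) in *; set (n := Ci * (1 + bmu D (chi z)) / 2) in *.
(* [Fm] and [Fn] say that the new pair (m, n) is the old pair times the adjugate of the Jacobian
   matrix, divided by [den]; the Jacobian inside kappa cancels the one in the inverse matrix. *)
assert (Fm : (1 - pull_num chi (bmu D) z / den) / 2
  = (RtoC (Im (dy chi z)) * m - RtoC (Re (dy chi z)) * n) / den).
{ transitivity ((den - pull_num chi (bmu D) z) / 2 / den); [field; exact N|].
  f_equal; unfold den, pull_den, pull_num, dz, dzbar, m, n.
  destruct (dx chi z), (dy chi z), (bmu D (chi z)); apply C_ext; cbn; field. }
assert (Fn : Ci * (1 + pull_num chi (bmu D) z / den) / 2
  = (RtoC (Re (dx chi z)) * n - RtoC (Im (dx chi z)) * m) / den).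
{ transitivity (Ci * (den + pull_num chi (bmu D) z) / 2 / den); [field; exact N|].
  f_equal; unfold den, pull_den, pull_num, dz, dzbar, m, n.
  destruct (dx chi z), (dy chi z), (bmu D (chi z)); apply C_ext; cbn; field. }
assert (FJ : RtoC (jac chi z) = RtoC (Re (dx chi z)) * RtoC (Im (dy chi z))
                               - RtoC (Re (dy chi z)) * RtoC (Im (dx chi z))).
{ rewrite jac_det; unfold det2; cbn [m11 m12 m21 m22].
  rewrite RtoC_minus, !RtoC_mult; reflexivity. }
rewrite Fm, Fn.
split; [|split; [|split]].
- f_equal; field; split; trivial.
- f_equal; field; split; trivial.
- rewrite FJ; f_equal; field; exact N.
- rewrite <- E4; unfold rowapp; cbn [fst snd]; ring.
Qed.

(** Covectors are carried over by the inverse transpose of the Jacobian matrix. *)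
Lemma conic_coord_change (chi : C -> C) (L : rsys) (z : C) (x y : R) :
  (0 < jac chi z)%R ->
  conic (coord_change chi L) z x y
  = conic L (chi z) ((Im (dy chi z) * x - Im (dx chi z) * y) / jac chi z)
                    ((Re (dx chi z) * y - Re (dy chi z) * x) / jac chi z).
Proof.
intros HJ; unfold conic; f_equal; cbn [coord_change sA1 sA2].
unfold minv, mscal, madd; rewrite <- jac_det; cbn [m11 m12 m21 m22].
f_equal; field; lra.
Qed.

Lemma elliptic_coord_change (Om' Om : C -> Prop) (chi : C -> C) (L : rsys) :
  (forall z, Om' z -> (0 < jac chi z)%R) -> (forall z, Om' z -> Om (chi z)) ->
  elliptic Om L -> elliptic Om' (coord_change chi L).
Proof.
intros HJ Hmap HE z Hz x y N; assert (J := HJ z Hz).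
rewrite conic_coord_change by exact J.
apply HE; [apply Hmap, Hz|].
intros [E1 E2]%pair_equal_spec; apply N; rewrite jac_det in *.
unfold det2 in *; cbn [m11 m12 m21 m22] in *.
revert J E1 E2; generalize (Re (dx chi z)) (Re (dy chi z)) (Im (dx chi z)) (Im (dy chi z)).
intros a b c d J E1 E2; f_equal.
- transitivity (a * ((d * x - c * y) / (a * d - b * c))
    + c * ((a * y - b * x) / (a * d - b * c)))%R; [field; lra|rewrite E1, E2; ring].
- transitivity (b * ((d * x - c * y) / (a * d - b * c))
    + d * ((a * y - b * x) / (a * d - b * c)))%R; [field; lra|rewrite E1, E2; ring].
Qed.

Lemma pullback_C0 (Om' Om : C -> Prop) (chi : C -> C) (D : bv) (f : C -> C) :
  open Om' -> isC1 Om' chi -> (forall z, Om' z -> (0 < jac chi z)%R) ->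
  (forall z, Om' z -> Om (chi z)) -> isC0 Om (bmu D) ->
  (forall z, Om z -> (Cmod (bmu D z) < 1)%R) -> isC0 Om f ->
  isC0 Om' (fun z => RtoC (jac chi z) / pull_den chi (bmu D) z * f (chi z)).
Proof.
intros Ho' Hchi HJ Hmap Cm Hm Hf.
assert (Cx := isC1_dxC0 _ _ Hchi); assert (Cy := isC1_dyC0 _ _ Hchi).
assert (Ch : isC0 Om' (fun _ => / 2)) by apply isC0_const.
assert (Ci' : isC0 Om' (fun _ => Ci)) by apply isC0_const.
assert (Z : isC0 Om' (dz chi))
  by exact (isC0_mult _ _ _ Ch (isC0_minus _ _ _ Cx (isC0_mult _ _ _ Ci' Cy))).
assert (Zb : isC0 Om' (dzbar chi))
  by exact (isC0_mult _ _ _ Ch (isC0_plus _ _ _ Cx (isC0_mult _ _ _ Ci' Cy))).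
apply isC0_mult; [|exact (isC0_comp Om' Om chi Ho' Hchi Hmap f Hf)].
apply isC0_div.
- apply isC0_RtoC.
  apply (isC0R_ext Om' (fun z => det2 (Mat2 (Re (dx chi z)) (Re (dy chi z))
                                        (Im (dx chi z)) (Im (dy chi z))))).
  + exact Ho'.
  + intros z _; symmetry; apply jac_det.
  + apply isC0_C0R in Cx, Cy; destruct Cx as [X1 X2], Cy as [Y1 Y2].
    exact (isC0R_minus _ _ _ (isC0R_mult _ _ _ X1 Y2) (isC0R_mult _ _ _ Y1 X2)).
- apply isC0_plus; [exact Z|].
  exact (isC0_mult _ _ _ (isC0_comp Om' Om chi Ho' Hchi Hmap _ Cm) (isC0_conj _ _ Zb)).
- intros z Hz; apply pull_den_neq_0; [apply HJ, Hz|apply Hm, Hmap, Hz].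
Qed.

Lemma BV_ext (Om : C -> Prop) (D D' : bv) :
  open Om -> bv_eq Om D D' -> BV Om D -> BV Om D'.
Proof.
intros Ho E (B1 & B2 & B3 & B4 & B5).
assert (X : forall f g : C -> C, (forall z, Om z -> f z = g z) -> isC0 Om f -> isC0 Om g).
{ intros f g H; rewrite !isC0_C0R; intros [K1 K2]; split.
  - apply (isC0R_ext Om _ _ Ho (fun z Hz => f_equal Re (H z Hz)) K1).
  - apply (isC0R_ext Om _ _ Ho (fun z Hz => f_equal Im (H z Hz)) K2). }
split; [apply (isC1_ext Om (bmu D)); trivial; apply E|].
split; [intros z Hz; rewrite <- (proj1 (E z Hz)); auto|].
split; [|split].
- apply (X (bA D)); trivial; apply E.
- apply (X (bB D)); trivial; apply E.
- apply (X (bF D)); trivial; apply E.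
Qed.

(** * Comparison of representing data with the normal form *)

Lemma represents_pipeline_gauge (Om : C -> Prop) (L : rsys) om D :
  open Om -> elliptic Om L -> has_skeleton_form Om L ->
  (forall z, Om z -> (Cmod (bmu D z) < 1)%R) -> represents Om L om D ->
  exists phi, isC1 Om phi /\ (forall z, Om z -> phi z <> 0) /\
    bv_eq Om D (gauge phi (pipeline L)).
Proof.
intros Ho HE HS Hm HR.
assert (HP : forall z, Om z -> det2 (sA1 L z) <> 0%R)
  by (intros z; apply elliptic_det_sA1, HE).
assert (HQ := pipeline_represents Om L Ho HE HS).
assert (Hq := pmu_lt_1 Om L HE HS).
assert (Hl := lam_neq_0 Om L HE HS).
exists (fun z => snd (om z) / lam (skeleton_of L) z); split; [|split].
- exact (represents_phi_C1 Om L _ om (pipeline L) D Ho HQ HR Hl).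
- intros z Hz; destruct (represents_ratio Om L _ om (pipeline L) D HP Hq Hm HQ HR Hl z Hz)
    as (_ & E & N).
  intros K; apply N; rewrite E; cbn [omega0 snd]; rewrite K; ring.
- exact (represents_gauge Om L _ om (pipeline L) D Ho HP Hq Hm HQ HR Hl).
Qed.

(** The single bridge to all three invariance claims: once a BV datum represents L, it may replace
    the normal form of L in any invariant assignment. The extensionality clause is required because
    the gauge relation holds on [Om] only. *)
Lemma invariant_represents (T : Type) (I : (C -> Prop) -> bv -> T)
    (Om : C -> Prop) (L : rsys) om D :
  invariant_assignment I -> plane_domain Om -> elliptic Om L -> has_skeleton_form Om L ->
  BV Om D -> represents Om L om D -> I Om (pipeline L) = I Om D.
Proof.
intros (I1 & I2 & _) HO HE HS HB HR; assert (Ho := proj1 HO).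
destruct (represents_pipeline_gauge Om L om D Ho HE HS (proj1 (proj2 HB)) HR)
  as (phi & C1 & N & E).
rewrite <- (I2 Om (pipeline L) phi HO (pipeline_BV Om L Ho HE HS) C1 N).
symmetry; apply I1; trivial.
exact (BV_ext Om _ _ Ho E HB).
Qed.

Lemma represents_mu_pipeline (Om : C -> Prop) (L : rsys) om D z :
  open Om -> elliptic Om L -> has_skeleton_form Om L ->
  (forall z, Om z -> (Cmod (bmu D z) < 1)%R) -> represents Om L om D ->
  Om z -> bmu D z = bmu (pipeline L) z.
Proof.
intros Ho HE HS Hm HR Hz.
destruct (represents_pipeline_gauge Om L om D Ho HE HS Hm HR) as (phi & _ & _ & E).
exact (proj1 (E z Hz)).
Qed.

(** The formula for the pulled-back mu contains first derivatives of chi and so is only seen to be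
    continuous. But the pullback represents [coord_change chi L], whose normal form has the same mu,
    and that mu is C^1 by the assumed skeleton form. *)
Lemma pullback_BV (Om' Om : C -> Prop) (chi : C -> C) (L : rsys) om D :
  open Om' -> open Om -> isC1 Om' chi -> (forall z, Om' z -> (0 < jac chi z)%R) ->
  (forall z, Om' z -> Om (chi z)) -> BV Om D -> represents Om L om D ->
  elliptic Om L -> has_skeleton_form Om' (coord_change chi L) ->
  BV Om' (pullback chi D).
Proof.
intros Ho' Ho Hchi HJ Hmap (B1 & B2 & B3 & B4 & B5) HR HE HS.
assert (HE' := elliptic_coord_change Om' Om chi L HJ Hmap HE).
assert (Hm : forall z, Om' z -> (Cmod (bmu (pullback chi D) z) < 1)%R).
{ intros z Hz; apply pullback_mu_lt_1; [apply HJ, Hz|apply B2, Hmap, Hz]. }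
assert (Cm := isC1_C0 Om Ho _ B1).
split.
- apply (isC1_ext Om' (bmu (pipeline (coord_change chi L)))).
  + exact Ho'.
  + intros z Hz; symmetry.
    exact (represents_mu_pipeline Om' _ _ _ z Ho' HE' HS Hm
      (represents_pullback Om' Om chi L om D Ho' Ho Hchi HJ Hmap B2 HR) Hz).
  + apply (pipeline_BV Om' _ Ho' HE' HS).
- split; [exact Hm|].
  split; [|split]; apply (pullback_C0 Om' Om chi D); trivial.
Qed.

(** * Ingredients special to the substitution (phi, psi) *)

Lemma a11_det (L : rsys) (z : C) :
  a11 (skeleton_of L) z = (det2 (sA1 L z) / det2 (skel_den L z))%R.
Proof.
cbn [skeleton_of skel_sys left_mul sA1 a11]; unfold minv, mscal.
set (d := det2 (skel_den L z)).
unfold mmul, skel_den, det2, Rdiv; cbn [m11 m12 m21 m22]; ring.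
Qed.

(** Let c be the second column of S read as a complex number. The second columns of A1 S and A2 S
    are m c and lambda m c, and the determinant is Im (conj (m c) lambda m c). It is thus positive
    as soon as c is nonzero, for either sign of det S. *)
Lemma det_skel_den_sharp (S : C -> mat2 R) (D : bv) (z : C) :
  (Cmod (bmu D z) < 1)%R ->
  det2 (skel_den (subst S (realification D)) z)
  = ((m12 (S z) ^ 2 + m22 (S z) ^ 2) * (Cmod ((1 - bmu D z) / 2) ^ 2
      * Im (spectral_root (bmu D) z)))%R.
Proof.
intros Hm; rewrite Cmod_sq; unfold skel_den; cbn [subst realification sA1 sA2].
rewrite (n_root _ _ (mu_neq_1 _ Hm)).
generalize (spectral_root (bmu D) z) ((1 - bmu D z) / 2); intros [p q] [a b].
unfold rlin, mmul, det2; cbn; ring.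
Qed.

Lemma det_Smat (phi psi : C -> C) (z : C) :
  det2 (Smat phi psi z) = (Cmod (phi z) ^ 2 - Cmod (psi z) ^ 2)%R.
Proof. rewrite !Cmod_sq; unfold Smat, rlin, det2; cbn [m11 m12 m21 m22]; ring. Qed.

Lemma gauge_ext (Om : C -> Prop) (phi phi' : C -> C) (D : bv) :
  open Om -> (forall z, Om z -> phi z = phi' z) -> bv_eq Om (gauge phi D) (gauge phi' D).
Proof.
intros Ho E z Hz; unfold gauge, dz, dzbar; cbn [bmu bA bB bF].
rewrite (dx_ext Om phi phi' z Ho E Hz), (dy_ext Om phi phi' z Ho E Hz), (E z Hz); auto.
Qed.

Lemma Cmod_phase (b w : C) : w <> 0 -> Cmod (b * (w / Cconj w)) = Cmod b.
Proof.
intros H; rewrite Cmod_mult, Cmod_div by (apply Cconj_neq_0, H).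
rewrite Cmod_conj; field; apply Rgt_not_eq, Cmod_gt_0, H.
Qed.

Lemma bv_eq_trans (Om : C -> Prop) (D D' D'' : bv) :
  bv_eq Om D D' -> bv_eq Om D' D'' -> bv_eq Om D D''.
Proof.
intros H K z Hz; destruct (H z Hz) as (-> & -> & -> & ->); apply K, Hz.
Qed.

Theorem corollary6p4 :
  (forall (Om : C -> Prop) (D : bv) (phi psi : C -> C),
     plane_domain Om -> BV Om D -> isC1 Om phi -> isC1 Om psi ->
     (forall z, Om z -> (Cmod (phi z) < Cmod (psi z))%R) ->
     let l := spectral_root (bmu D) in
     let L := sharp phi psi D in
     let s := skeleton_of L in
     let DS := pipeline L in
     (forall z, Om z ->
        det2 (Smat phi psi z) = (Cmod (phi z) ^ 2 - Cmod (psi z) ^ 2)%R /\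
        (det2 (Smat phi psi z) < 0)%R /\
        forall xi1 xi2 : R,
          conic L z xi1 xi2
          = (det2 (Smat phi psi z) * conic (realification D) z xi1 xi2)%R) /\
     elliptic Om L /\
     has_skeleton_form Om L /\
     (forall z, Om z ->
        (a11 s z < 0)%R /\ (0 < 4 * alpha s z - beta s z ^ 2)%R /\
        lam s z = l z /\ (0 < Im (lam s z))%R) /\
     (forall V : C -> C, isC1 Om V ->
        (forall z, Om z -> sys_res L V z = RtoC 0) <->
        (forall z, Om z -> Res DS (pipeline_unknown s V) z = RtoC 0)) /\
     BV Om DS /\
     eigenrow Om L l (omega0 s l) /\
     bv_eq Om DS (eigenpairing L l (omega0 s l)) /\
     isC1 Om (fun z => (- Ci * l z / (phi z - psi z))%C) /\
     (forall z, Om z -> (- Ci * l z / (phi z - psi z))%C <> RtoC 0) /\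
     bv_eq Om DS
       (gauge (fun z => (- Ci * l z / (phi z - psi z))%C) D) /\
     (forall z, Om z ->
        bmu DS z = bmu D z /\ Cmod (bB DS z) = Cmod (bB D z) /\
        Theta DS z = Theta D z)) /\
  (forall (T : Type) (I : (C -> Prop) -> bv -> T),
     invariant_assignment I ->
     forall (Om : C -> Prop) (L : rsys),
       plane_domain Om -> elliptic Om L -> has_skeleton_form Om L ->
       (extended_class Om L /\ BV Om (pipeline L)) /\
       (forall M : C -> mat2 R, entrywise (isC0R Om) M -> GL2 Om M ->
          (extended_class Om (left_mul M L) /\ BV Om (pipeline (left_mul M L))) /\
          I Om (pipeline (left_mul M L)) = I Om (pipeline L)) /\
       (forall S : C -> mat2 R, entrywise (isC1R Om) S -> GL2 Om S ->
          (extended_class Om (subst S L) /\ BV Om (pipeline (subst S L))) /\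
          I Om (pipeline (subst S L)) = I Om (pipeline L)) /\
       (forall (Om' : C -> Prop) (chi : C -> C),
          plane_domain Om' -> or_diffeo Om' Om chi ->
          has_skeleton_form Om' (coord_change chi L) ->
          (extended_class Om' (coord_change chi L) /\
           BV Om' (pipeline (coord_change chi L))) /\
          I Om' (pipeline (coord_change chi L)) = I Om (pipeline L))).
Proof.
split.
{ intros Om D phi psi HO HB Cphi Cpsi Hlt l L s DS; assert (Ho := proj1 HO).
  destruct (HB) as (B1 & B2 & _).
  assert (Hdet : forall z, Om z -> (det2 (Smat phi psi z) < 0)%R).
  { intros z Hz; rewrite det_Smat.
    generalize (Hlt z Hz) (Cmod_ge_0 (phi z)) (Cmod_ge_0 (psi z)); nra. }
  assert (HG : GL2 Om (Smat phi psi)) by (intros z Hz; apply Rlt_not_eq, Hdet, Hz).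
  assert (CS : entrywise (isC1R Om) (Smat phi psi)) by exact (rlin_C1 Om _ _ Ho Cphi Cpsi).
  assert (HE : elliptic Om L)
    by exact (elliptic_subst Om _ _ HG (elliptic_realification Om D B2)).
  assert (HS : has_skeleton_form Om L)
    by exact (has_skeleton_form_realification_subst Om _ D Ho HB CS HG).
  assert (HQ : BV Om DS) by exact (pipeline_BV Om L Ho HE HS).
  assert (HP : forall z, Om z -> det2 (sA1 L z) <> 0%R)
    by (intros z; apply elliptic_det_sA1, HE).
  assert (RS : represents Om L (omega0 s (lam s)) DS)
    by exact (pipeline_represents Om L Ho HE HS).
  (* D itself represents the substituted system, through (1, i) S; comparison with the normal form
     and [omega0] drives everything below. *)
  assert (RD := represents_subst Om _ _ _ _ Ho CS HG (represents_realification Om D)).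
  change (subst (Smat phi psi) (realification D)) with L in RD.
  assert (Emu : forall z, Om z -> bmu D z = bmu DS z)
    by (intros z Hz; exact (represents_mu_pipeline Om L _ D z Ho HE HS B2 RD Hz)).
  assert (El : forall z, Om z -> lam s z = l z).
  { intros z Hz; transitivity (spectral_root (bmu DS) z).
    - symmetry; exact (pmu_root Om L HE HS z Hz).
    - unfold l, spectral_root; rewrite (Emu z Hz); reflexivity. }
  assert (Elam : forall z, Om z -> l z = spectral_root (bmu DS) z).
  { intros z Hz; unfold l, spectral_root; rewrite (Emu z Hz); reflexivity. }
  (* The eigenpairing claim is stated with the spectral root l of D, so the row is rewritten from
     [lam s] to l; both agree on [Om]. *)
  assert (RS' : represents Om L (omega0 s l) DS).
  { apply (represents_ext Om L (omega0 s (lam s))); trivial.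
    intros z Hz; unfold omega0; rewrite El; trivial. }
  assert (Nd : forall z, Om z -> phi z - psi z <> 0).
  { intros z Hz E; apply Cminus_eq_0 in E; generalize (Hlt z Hz); rewrite E; lra. }
  assert (Es : forall z, snd (rowmul (RtoC 1, Ci) (toC (Smat phi psi z)))
                         = Ci * (phi z - psi z)).
  { intros z; unfold Smat; rewrite rowmul_rlin; reflexivity. }
  assert (Ns : forall z, Om z ->
     snd (rowmul (RtoC 1, Ci) (toC (Smat phi psi z))) <> 0).
  { intros z Hz; rewrite Es; apply Cmult_neq_0; [exact Ci_neq_0|apply Nd, Hz]. }
  (* The gauge factor is the ratio of second entries, l / (i (phi - psi)), and 1 / i = - i. *)
  assert (Eg : forall z, Om z ->
     snd (omega0 s (lam s) z) / snd (rowmul (RtoC 1, Ci) (toC (Smat phi psi z)))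
     = - Ci * l z / (phi z - psi z)).
  { intros z Hz; rewrite Es; cbn [omega0 snd]; rewrite El by exact Hz.
    transitivity (- (Ci * Ci) * (l z / (Ci * (phi z - psi z)))).
    - rewrite Ci2; ring.
    - field; split; [apply Nd, Hz|exact Ci_neq_0]. }
  assert (Gd : bv_eq Om DS (gauge (fun z => - Ci * l z / (phi z - psi z)) D)).
  { apply (bv_eq_trans Om _ _ _ (represents_gauge Om L _ _ D DS Ho HP B2
      (proj1 (proj2 HQ)) RD RS Ns)).
    exact (gauge_ext Om _ _ D Ho Eg). }
  assert (N : forall z, Om z -> - Ci * l z / (phi z - psi z) <> 0).
  { intros z Hz E; apply (lam_neq_0 Om L HE HS z Hz); fold s; rewrite El by exact Hz.
    apply (Cmult_eq_0 (- Ci / (phi z - psi z))).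
    - rewrite <- E; field; apply Nd, Hz.
    - intros K; apply Ci_neq_0.
      transitivity (- (- Ci / (phi z - psi z)) * (phi z - psi z));
        [field; apply Nd, Hz|rewrite K; ring]. }
  split; [|split; [exact HE|split; [exact HS|split; [|split; [|split; [exact HQ|split]]]]]].
  - intros z Hz; split; [apply det_Smat|split; [apply Hdet, Hz|]].
    intros x y; apply conic_subst.
  - intros z Hz; split; [|split; [exact (structure_disc Om L HE HS z Hz)|]].
    (* In skeleton form the second column of A1 is (0, 1), so [a11] is its determinant, the quotient
       of det A1 by det [skel_den]. Here the former is |m|^2 det S < 0 and the latter is
       positive. *)
    + unfold s; rewrite a11_det.
      assert (I := Im_spectral_root _ _ (B2 z Hz)).
      assert (M := proj1 (Cmod_gt_0 _) (Chalf_neq_0 _ (mu_neq_1 _ (B2 z Hz)))).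
      unfold L, sharp at 1 2; rewrite det_skel_den_sharp by exact (B2 z Hz).
      assert (Ed : det2 (sA1 (subst (Smat phi psi) (realification D)) z)
        = (det2 (Smat phi psi z) * Cmod ((1 - bmu D z) / 2) ^ 2)%R).
      { cbn [subst sA1]; rewrite det2_mmul, Rmult_comm; f_equal.
        rewrite Cmod_sq; cbn [realification sA1]; generalize ((1 - bmu D z) / 2).
        intros [a b]; unfold rlin, det2; cbn; ring. }
      rewrite Ed.
      set (k := Cmod ((1 - bmu D z) / 2)) in *.
      (* The second column of S is nonzero, since det S is. *)
      assert (P : (0 < m12 (Smat phi psi z) ^ 2 + m22 (Smat phi psi z) ^ 2)%R).
      { generalize (Hdet z Hz) (pow2_ge_0 (m12 (Smat phi psi z)))
          (pow2_ge_0 (m22 (Smat phi psi z))); intros D0 P1 P2.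
        destruct (Rle_lt_or_eq_dec _ _ P1) as [|Z1]; [lra|].
        destruct (Rle_lt_or_eq_dec _ _ P2) as [|Z2]; [lra|].
        assert (m12 (Smat phi psi z) = 0)%R as K1 by nra.
        assert (m22 (Smat phi psi z) = 0)%R as K2 by nra.
        unfold det2 in D0; rewrite K1, K2 in D0; lra. }
      apply Ropp_lt_cancel; rewrite Ropp_0, <- Rdiv_opp_l.
      apply Rdiv_lt_0_compat.
      * rewrite Ropp_mult_distr_l.
        apply Rmult_lt_0_compat; [generalize (Hdet z Hz); lra|apply pow_lt, M].
      * apply Rmult_lt_0_compat; [exact P|].
        apply Rmult_lt_0_compat; [apply pow_lt, M|exact I].
    + split; [apply El, Hz|exact (Im_lam_pos Om L HE HS z Hz)].
  - intros V HV; rewrite (represents_solutions Om L _ DS V Ho (proj1 (proj2 HQ)) RS HV).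
    assert (E : forall p, rowapp (omega0 s (lam s) p) (V p) = pipeline_unknown s V p).
    { intros p; unfold rowapp, omega0, pipeline_unknown; cbn [fst snd].
      rewrite RtoC_minus, !RtoC_mult; ring. }
    assert (ER : forall z, Om z ->
       Res DS (fun p => rowapp (omega0 s (lam s) p) (V p)) z = Res DS (pipeline_unknown s V) z).
    { intros z Hz; unfold Res, dz, dzbar.
      rewrite (dx_ext Om _ _ z Ho (fun p _ => E p) Hz),
        (dy_ext Om _ _ z Ho (fun p _ => E p) Hz), E; reflexivity. }
    split; intros H z Hz; [rewrite <- ER|rewrite ER]; auto.
  - exact (represents_eigenrow Om L _ l DS HP (proj1 (proj2 HQ)) Elam RS').
  - split; [exact (represents_eigenpairing Om L _ l DS HP (proj1 (proj2 HQ)) Elam RS')|].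
    split; [|split; [exact N|split; [exact Gd|]]].
    + apply (isC1_ext Om _ _ Ho Eg).
      exact (represents_phi_C1 Om L _ _ D DS Ho RD RS Ns).
    + intros z Hz; destruct (Gd z Hz) as (_ & _ & E & _).
      assert (Eb : Cmod (bB DS z) = Cmod (bB D z))
        by (rewrite E; apply Cmod_phase, N, Hz).
      split; [symmetry; apply Emu, Hz|split; [exact Eb|]].
      unfold Theta; rewrite Eb, (Emu z Hz); reflexivity. }
{ intros T I HI Om L HO HE HS; assert (Ho := proj1 HO).
  assert (X : forall Om L, open Om -> elliptic Om L -> has_skeleton_form Om L ->
    extended_class Om L /\ BV Om (pipeline L)).
  { clear; intros Om L Ho HE HS; split;
      [apply elliptic_extended|apply pipeline_BV]; trivial. }
  assert (HB := pipeline_BV Om L Ho HE HS).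
  assert (HR := pipeline_represents Om L Ho HE HS).
  split; [auto|split; [|split]].
  - intros M _ HM.
    assert (HE' := elliptic_left_mul Om M L HM HE).
    assert (HS' := has_skeleton_form_left_mul Om M L Ho HM HS).
    split; [auto|].
    exact (invariant_represents T I Om _ _ _ HI HO HE' HS' HB
             (represents_left_mul Om M L _ _ HM HR)).
  - intros S CS HG.
    assert (HE' := elliptic_subst Om S L HG HE).
    assert (HS' := has_skeleton_form_subst Om Ho S L CS HG HE HS).
    split; [auto|].
    exact (invariant_represents T I Om _ _ _ HI HO HE' HS' HB
             (represents_subst Om S L _ _ Ho CS HG HR)).
  - intros Om' chi HO' Hchi HS'.
    assert (Ho' := proj1 HO'); destruct (Hchi) as (C1 & HJ & theta & _ & Hm & _).
    assert (Hmap : forall z, Om' z -> Om (chi z)) by (intros z Hz; apply Hm, Hz).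
    assert (HE' := elliptic_coord_change Om' Om chi L HJ Hmap HE).
    assert (HB' := pullback_BV Om' Om chi L _ _ Ho' Ho C1 HJ Hmap HB HR HE HS').
    split; [auto|].
    (* Pullback invariance moves the normal form of L to [Om']; there it represents the transformed
       system, and gauge invariance finishes. *)
    rewrite <- (proj2 (proj2 HI) Om' Om chi (pipeline L) HO' HO Hchi HB HB').
    exact (invariant_represents T I Om' _ _ _ HI HO' HE' HS' HB'
      (represents_pullback Om' Om chi L _ _ Ho' Ho C1 HJ Hmap (proj1 (proj2 HB)) HR)). }
Qed.
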